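(* Let $S$ be a skew shape poset, and let $m'\lessdot m$ and $M'\lessdot M$ be elements of $S$ such that $sw(m)=ne(M')=\varnothing$. (a) The bijection $\aleph\colon U_S\to D_S$ restricts to a bijection from $U_S(\mathscr C^{se}_{m,M})$ to $D_S(\mathscr C^{nw}_{m',M'})$. (b) Let $x\in\mathbb R_+^S$ and $z=\tilde\rho^{-1}(x)$. Then $w_{\mathscr C^{se}_{m,M}}(x)=w_{\mathscr C^{nw}_{m',M'}}(z)$.
   Context: Notation: $\mathbb R_+$ is the positive reals, $[n]=\{1,\dots,n\}$, $\lessdot$ denotes cover relations. For a collection $\mathscr C$ of chains, $w_{\mathscr C}(x)=\sum_{C\in\mathscr C}\prod_{p\in C}x_p$. A subposet $I$ of a poset $P$ is saturated if it is induced and every cover relation of $I$ is a cover relation of $P$. Let $r\ge s$ be positive integers. A skew shape poset $S$ is a saturated subposet of $[r]\times[s]$ (componentwise order) containing $(1,1)$ and $(r,s)$ such that if $(i-1,j),(i,j-1)\in S$, then $(i,j)\in S$. Antichain rowmotion on $S$: the toggle $\tau_p\colon\mathbb R_+^S\to\mathbb R_+^S$ replaces $x_p$ by $\left(\sum_{C}\prod_{q\in C}x_q\right)^{-1}$, $C$ ranging over all maximal chains of $S$ containing $p$, and fixes other coordinates; $\tilde\rho=\tau_{L^{-1}(n)}\circ\cdots\circ\tau_{L^{-1}(1)}$ for any linear extension $L\colon S\to[n]$ (a bijection independent of $L$). Arborescences: let $\widehat S$ be $S$ with a new minimum $\hat0$ and new maximum $\hat1$. An upward arborescence of $S$ is a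 subgraph of the Hasse diagram of $\widehat S\setminus\{\hat1\}$ containing, for each $p\in S$, exactly one edge joining $p$ to an element covered by $p$. A downward arborescence is a subgraph of the Hasse diagram of $\widehat S\setminus\{\hat0\}$ containing, for each $p\in S$, exactly one edge joining $p$ to an element covering $p$. $U_S$, $D_S$ are the sets of upward and downward arborescences. For a saturated chain $C$ in $S$, $U_S(C)$ (resp. $D_S(C)$) is the set of those upward (resp. downward) arborescences containing all edges (cover relations) of $C$; for a collection $\mathscr C$ of chains with common minimum and maximum, $U_S(\mathscr C)=\bigsqcup_{C\in\mathscr C}U_S(C)$ and $D_S(\mathscr C)=\bigsqcup_{C\in\mathscr C}D_S(C)$. The bijection $\aleph\colon U_S\to D_S$: regard the Hasse diagram of $S$ as drawn in $\mathbb R^2$ with vertices at the points $(i,j)$ and edges as unit segments. For $T\in U_S$, let $\overline T$ be the translate by $(-\frac12,-\frac12)$ of the edges of $T$ joining elements of $S$. Then $\aleph(T)$ consists of all edges of the Hasse diagram of $S$ that do not intersect $\overline T$, together with all forced edges, i.e. all edges $p\lessdot q$ of $\widehat S$ with $p\in S$ such that $q$ is the only element of $\widehat S$ covering $p$. Directions (first coordinate increases to the northwest, second to the northeast): for $p=(i,j)\in S$, $se(p)$ is the set of elements of $S$ of the form $(i-1-k,j+k)$ with $k\ge0$; $sw(p)$ is the set of elements of $S$ of the form $(i-1-k,j+k)$ with $k<0$; $nw(p)=\{q\in S: p\in se(q)\}$; $ne(p)=\{q\in S:p\in sw(q)\}$. $\mathscr C_{p,q}$ is the set of all saturated chains in $S$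 with minimum $p$ and maximum $q$ (a single one-element chain if $p=q$, empty if $p\not\le q$), and $\mathscr C^{se}_{p,q}$ (resp. $\mathscr C^{nw}_{p,q}$) is the subset of chains $C$ with $se(u)\neq\varnothing$ (resp. $nw(u)\ne\varnothing$) for all $u\in C$. *)

(* Defs.v *)
From HB Require Import structures.
From mathcomp Require Import all_boot all_order all_algebra.
From mathcomp Require Import boolp reals.
Set Implicit Arguments.
Unset Strict Implicit.
Unset Printing Implicit Defensive.
Import Order.TTheory GRing.Theory Num.Theory.
Local Open Scope ring_scope.

(** A subposet is given by its set of elements, with the induced order. *)

(** [covers lt A a b]: b covers a in the subposet A. *)
Definition covers (T : finType) (lt : rel T) (A : {set T}) : rel T :=
  fun a b => [&& a \in A, b \in A, lt a b
               & [forall c in A, ~~ (lt a c && lt c b)]].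

(** Edges of a Hasse diagram are pairs (lower end, upper end). *)
Definition hasse (T : finType) (lt : rel T) (A : {set T}) : {set T * T} :=
  [set e | covers lt A e.1 e.2].

Definition saturated (T : finType) (lt : rel T) (A I : {set T}) : bool :=
  (I \subset A) && [forall a, forall b, covers lt I a b ==> covers lt A a b].

Definition is_chain d (P : finPOrderType d) (A C : {set P}) : bool :=
  (C \subset A) && [forall a in C, forall b in C, (a >=< b)%O].

Definition maxchain d (P : finPOrderType d) (A C : {set P}) : bool :=
  maxset (is_chain A) C.

(** The cell (i, j) of [r] x [s] is represented by the ordinals i - 1 and
    j - 1; apart from the two extreme cells, everything below only involves
    differences of coordinates.  The order is the componentwise one. *)
Definition cell (r s : nat) := ('I_r *p 'I_s)%type.

Definition ltc {r s : nat} : rel (cell r s) := fun p q => (p < q)%O.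

Definition skew_shape (r s : nat) (S : {set cell r s}) : Prop :=
  [/\ saturated ltc setT S,
      exists2 p : cell r s, p \in S & p.1 = 0%N :> nat /\ p.2 = 0%N :> nat,
      exists2 p : cell r s, p \in S & p.1 = r.-1 :> nat /\ p.2 = s.-1 :> nat
    & forall (i' i : 'I_r) (j' j : 'I_s),
        i = i'.+1 :> nat -> j = j'.+1 :> nat ->
        ((i', j) : cell r s) \in S -> ((i, j') : cell r s) \in S ->
        ((i, j) : cell r s) \in S].

Definition se (r s : nat) (S : {set cell r s}) (p : cell r s) : {set cell r s} :=
  [set q in S | `[< exists k : int,
     [/\ 0 <= k, (q.1 : nat)%:Z = (p.1 : nat)%:Z - 1 - k
       & (q.2 : nat)%:Z = (p.2 : nat)%:Z + k] >] ].

Definition sw (r s : nat) (S : {set cell r s}) (p : cell r s) : {set cell r s} :=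
  [set q in S | `[< exists k : int,
     [/\ k < 0, (q.1 : nat)%:Z = (p.1 : nat)%:Z - 1 - k
       & (q.2 : nat)%:Z = (p.2 : nat)%:Z + k] >] ].

Definition nw (r s : nat) (S : {set cell r s}) (p : cell r s) : {set cell r s} :=
  [set q in S | p \in se S q].

Definition ne (r s : nat) (S : {set cell r s}) (p : cell r s) : {set cell r s} :=
  [set q in S | p \in sw S q].

Definition satchains (r s : nat) (S : {set cell r s}) (p q : cell r s) :
    {set {set cell r s}} :=
  [set C | [&& is_chain S C, saturated ltc S C, p \in C, q \in C
             & [forall u in C, (p <= u)%O && (u <= q)%O]]].

Definition satchains_se (r s : nat) (S : {set cell r s}) (p q : cell r s) :
    {set {set cell r s}} :=
  [set C in satchains S p q | [forall u in C, se S u != set0]].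

Definition satchains_nw (r s : nat) (S : {set cell r s}) (p q : cell r s) :
    {set {set cell r s}} :=
  [set C in satchains S p q | [forall u in C, nw S u != set0]].

Definition weight (R : realType) (T : finType) (CC : {set {set T}})
    (x : T -> R) : R :=
  \sum_(C in CC) \prod_(p in C) x p.

(** A point of R_+^S is a function on all cells that is positive on S; its
    values outside S are irrelevant, and labelings are compared on S only. *)

Definition positive_on (R : realType) (T : finType) (S : {set T})
    (x : T -> R) : Prop :=
  {in S, forall p, 0 < x p}.

Definition toggle (R : realType) (r s : nat) (S : {set cell r s})
    (p : cell r s) (x : cell r s -> R) : cell r s -> R :=
  fun u => if u == p
           then (\sum_(C : {set cell r s} | maxchain S C && (p \in C))
                   \prod_(q in C) x q)^-1
           else x u.

(** The linear extension L : S -> [n] is given as the list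
    L^-1(1), ..., L^-1(n). *)
Definition linear_extension (r s : nat) (S : {set cell r s})
    (L : seq (cell r s)) : Prop :=
  [/\ uniq L, L =i S
    & {in S &, forall p q : cell r s, (p < q)%O -> (index p L < index q L)%N}].

Definition rowmotion (R : realType) (r s : nat) (S : {set cell r s})
    (L : seq (cell r s)) (x : cell r s -> R) : cell r s -> R :=
  foldl (fun y p => toggle S p y) x L.

(** [inr false] is the new minimum and [inr true] the new maximum. *)
Definition hat (r s : nat) := (cell r s + bool)%type.
Definition hat0 {r s : nat} : hat r s := inr false.
Definition hat1 {r s : nat} : hat r s := inr true.

Definition hat_lt {r s : nat} : rel (hat r s) := fun a b =>
  match a, b with
  | inl p, inl q => ltc p q
  | inl _, inr c => c
  | inr c, inl _ => ~~ c
  | inr c, inr c' => ~~ c && c'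
  end.

Definition hat_set (r s : nat) (S : {set cell r s}) : {set hat r s} :=
  [set inl p | p in S] :|: [set hat0; hat1].

(** Subgraphs are given by their edges. *)
Definition graph (r s : nat) := {set hat r s * hat r s}.

Definition hat_edge (r s : nat) (e : cell r s * cell r s) :
    hat r s * hat r s := (inl e.1, inl e.2).

Definition up_arb (r s : nat) (S : {set cell r s}) : {set graph r s} :=
  [set T : graph r s | (T \subset hasse hat_lt (hat_set S :\ hat1)) &&
     [forall p in S, #|[set e in T | e.2 == inl p]| == 1%N]].

Definition down_arb (r s : nat) (S : {set cell r s}) : {set graph r s} :=
  [set T : graph r s | (T \subset hasse hat_lt (hat_set S :\ hat0)) &&
     [forall p in S, #|[set e in T | e.1 == inl p]| == 1%N]].

Definition containing (r s : nat) (F : {set graph r s}) (C : {set cell r s}) :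
    {set graph r s} :=
  [set T in F | [forall e in hasse ltc C, hat_edge e \in T]].

(** U_S(CC) and D_S(CC) for a collection CC of chains; the unions are disjoint
    when the chains share their minimum and maximum. *)
Definition up_arb_of (r s : nat) (S : {set cell r s})
    (CC : {set {set cell r s}}) : {set graph r s} :=
  \bigcup_(C in CC) containing (up_arb S) C.

Definition down_arb_of (r s : nat) (S : {set cell r s})
    (CC : {set {set cell r s}}) : {set graph r s} :=
  \bigcup_(C in CC) containing (down_arb S) C.

Definition point (R : realType) (r s : nat) (p : cell r s) : R * R :=
  ((p.1 : nat)%:R, (p.2 : nat)%:R).

Definition segment (R : realType) (a b : R * R) (u : R * R) : Prop :=
  exists t : R, [/\ 0 <= t <= 1, u.1 = (1 - t) * a.1 + t * b.1
                  & u.2 = (1 - t) * a.2 + t * b.2].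

Definition translate (R : realType) (a : R * R) : R * R :=
  (a.1 - 2^-1, a.2 - 2^-1).

Definition meets (R : realType) (r s : nat) (e : cell r s * cell r s)
    (T : graph r s) : Prop :=
  exists (f : cell r s * cell r s) (u : R * R),
    [/\ hat_edge f \in T,
        segment (point R e.1) (point R e.2) u
      & segment (translate (point R f.1)) (translate (point R f.2)) u].

Definition forced (r s : nat) (S : {set cell r s}) : graph r s :=
  [set e in hasse hat_lt (hat_set S) | (e.1 \in [set inl p | p in S]) &&
     [forall q, covers hat_lt (hat_set S) e.1 q ==> (q == e.2)]].

Definition aleph (R : realType) (r s : nat) (S : {set cell r s})
    (T : graph r s) : graph r s :=
  [set hat_edge e | e in hasse ltc S & ~~ `[< meets R e T >]] :|: forced S.

(* Main.v *)
Require Import Defs.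
From mathcomp Require Import all_boot all_order all_algebra.
From mathcomp Require Import reals.
From mathcomp Require Import zify ring lra.
From mathcomp Require Import boolp.
Set Implicit Arguments.
Unset Strict Implicit.
Unset Printing Implicit Defensive.
Import Order.TTheory GRing.Theory Num.Theory.

Local Open Scope ring_scope.

(** Every rank of [S] is an interval, so [se u] is nonempty iff [u - e1] is in
    [S], and [nw u] iff [u + e1] is.  On a unit square [a < q1, q2 < c] of [S],
    the edge from [a] to [q1] crosses the translate of the edge from [q1] to
    [c]; hence [aleph] sends the choice of [q2] below [c] to the choice of [q1]
    above [a], and conversely.

    Part (a) is then a non-crossing argument.  Let [H c c'] say that [c'] is in
    [se c].  If one walks down from [c] along [T] and up from [c'] along
    [aleph T], then one step down from [c] stays in relation [H] with [c'] iff
    one step up from [c'] stays in relation [H] with [c], provided the walks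
    stop at cells with empty [se], resp. empty [nw].  Iterating this from [M] and
    [m'], the walk down from [M] reaches [m] iff the walk up from [m'] reaches
    [M'].

    Part (b) is the same duality for random walks.  Let [X p] be the weight for
    [x] of the saturated chains from the minimum of [S] to [p], and [Z p] the
    weight for [z] of those from [p] to the maximum; rowmotion says that
    [X p * Z p = 1].  The walk stepping down from [c] to [v] with probability
    proportional to [X v] and the walk stepping up from [a] to [v] with
    probability proportional to [Z v] satisfy the same one-step identity, since
    on a square [X q2 / (X q1 + X q2) = Z q1 / (Z q1 + Z q2)].  Telescoping turns
    the hitting probabilities into weights of chains. *)

(** * Saturated chains for a strict order *)

Section Chains.
Variables (T : finType) (lt : rel T) (S A : {set T}).
Hypotheses (ltI : irreflexive lt) (ltT : transitive lt) (sAS : A \subset S).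

(** The elements are confined to [A] while saturation is measured in [S]; [A] will be [S], [Sse S]
    or [Snw S]. The order is an arbitrary relation, so that reversing it yields the dual
    statements. *)
Definition chains (p q : T) : {set {set T}} :=
  [set C : {set T} | [&& C \subset A,
    [forall a in C, forall b in C, [|| a == b, lt a b | lt b a]],
    saturated lt S C, p \in C, q \in C &
    [forall u in C, ((p == u) || lt p u) && ((u == q) || lt u q)]]].

Lemma chainsP (p q : T) (C : {set T}) :
  reflect [/\ C \subset A,
    {in C &, forall a b, [|| a == b, lt a b | lt b a]},
    {in C &, forall a b, covers lt C a b -> covers lt S a b}, p \in C /\ q \in C &
    {in C, forall u, ((p == u) || lt p u) /\ ((u == q) || lt u q)}]
  (C \in chains p q).
Proof.
rewrite inE; apply: (iffP and5P) => [[CA /forall_inP Ct /andP[CS /forallP Cs] pC]|].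
  case/andP=> qC /forall_inP Cb; split=> //.
  - by move=> a b aC bC; apply: (forall_inP (Ct a aC)).
  - by move=> a b aC bC; move/forallP: (Cs a) => /(_ b)/implyP.
  - by move=> u /Cb/andP.
case=> CA Ct Cs [pC qC] Cb; split=> //.
- by apply/forall_inP=> a aC; apply/forall_inP=> b bC; apply: Ct.
- rewrite /saturated (subset_trans CA sAS); apply/forallP=> a; apply/forallP=> b.
  by apply/implyP=> Cab; apply: Cs (Cab); case/and4P: Cab.
- by rewrite qC; apply/forall_inP=> u /Cb[-> ->].
Qed.

Lemma coversP (B : {set T}) (a b : T) :
  reflect [/\ a \in B, b \in B, lt a b & {in B, forall c, lt a c -> lt c b -> False}]
          (covers lt B a b).
Proof.
apply: (iffP and4P) => -[aB bB ab /= h]; split=> //.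
  by move=> c cB ac cb; move/forall_inP: h => /(_ c cB); rewrite ac cb.
by apply/forall_inP=> c cB; apply/negP=> /andP[ac cb]; apply: (h c).
Qed.

Lemma covers_sub (B C : {set T}) (a b : T) :
  B \subset C -> a \in B -> b \in B -> covers lt C a b -> covers lt B a b.
Proof.
move=> /subsetP BC aB bB /coversP[_ _ ab h]; apply/coversP; split=> // c /BC cC.
exact: h.
Qed.

Lemma rel_asym (a b : T) : lt a b -> lt b a -> False.
Proof. by move=> ab ba; move: (ltT ab ba); rewrite ltI. Qed.

(** Among the [v] in [B] with [a <= v < b], take one with the most elements below it: anything
    strictly between it and [b] would have a strictly larger down-set. *)
Lemma covers_ex (B : {set T}) (a b : T) : a \in B -> b \in B -> lt a b ->
  exists2 v, covers lt B v b & (a == v) || lt a v.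
Proof.
move=> aB bB ab.
pose Q := [pred v | [&& v \in B, lt v b & (a == v) || lt a v]].
have Qa : Q a by rewrite /= aB ab eqxx.
case: (@arg_maxnP _ a Q (fun v => #|[set u | lt u v]|) Qa) => v /and3P[vB vb av] vmax.
exists v => //; apply/coversP; split=> // c cB vc cb.
have : Q c.
  rewrite /= cB cb /=; case/orP: av => [/eqP->|av]; rewrite ?vc ?orbT //.
  by rewrite (ltT av vc) orbT.
move/vmax; rewrite /= leqNgt => /negP; apply; apply: proper_card.
apply/properP; split; first by apply/subsetP=> u; rewrite !inE => /ltT; apply.
by exists v; rewrite inE ?ltI.
Qed.

Lemma chains_notin (p q v : T) (C : {set T}) :
  covers lt S v q -> C \in chains p v -> q \notin C.
Proof.
case/coversP=> _ _ vq _ /chainsP[_ _ _ _ Cb]; apply/negP=> /Cb[_].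
by case/orP=> [/eqP qv|/(rel_asym vq)//]; move: vq; rewrite qv ltI.
Qed.

(** The second conclusion records the only new edge; through it edge conditions are propagated along
    chains in [edges_in_rcons]. *)
Lemma chains_rcons (p q v : T) (C : {set T}) : q \in A ->
  covers lt S v q -> C \in chains p v ->
  q |: C \in chains p q /\
  (forall a b, covers lt (q |: C) a b = covers lt C a b || (a == v) && (b == q)).
Proof.
move=> qA vq Cpv; have qC := chains_notin vq Cpv.
case/chainsP: Cpv => CA Ct Cs [pC vC] Cb; case/coversP: (vq) => vS qS lvq hvq.
have Cq u : u \in C -> lt u q.
  by case/Cb=> _ /orP[/eqP->//|uv]; apply: ltT lvq.
have covE a b : covers lt (q |: C) a b = covers lt C a b || (a == v) && (b == q).
  apply/idP/orP=> [|[/coversP[aC bC ab h]|/andP[/eqP-> /eqP->]]].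
  - case/coversP=> /setU1P[->|aC] /setU1P[->|bC] ab h.
    + by rewrite ltI in ab.
    + by case: (rel_asym ab (Cq _ bC)).
    + right; rewrite eqxx andbT; case/Cb: (aC) => _ /orP[//|av].
      by case: (h v); rewrite ?in_setU1 ?vC ?orbT.
    + left; apply/coversP; split=> // c cC; apply: h; by rewrite in_setU1 cC orbT.
  - apply/coversP; split; rewrite ?in_setU1 ?aC ?bC ?orbT // => c /setU1P[->|/h//].
    by move=> _ /(rel_asym (Cq _ bC)).
  - apply/coversP; split; rewrite ?setU11 ?in_setU1 ?vC ?orbT // => c /setU1P[->|cC].
      by rewrite ltI.
    by apply: hvq; apply: (subsetP sAS); apply: (subsetP CA).
split=> //; apply/chainsP; split.
- by rewrite subUset sub1set qA.
- move=> a b /setU1P[->|aC] /setU1P[->|bC]; first by rewrite eqxx.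
  + by rewrite (Cq b bC) !orbT.
  + by rewrite (Cq a aC) orbT.
  + exact: Ct.
- move=> a b _ _; rewrite covE => /orP[ab|/andP[/eqP-> /eqP->]//].
  by apply: Cs (ab); case/coversP: ab.
- by rewrite setU11 in_setU1 pC orbT.
- move=> u /setU1P[->|uC]; first by rewrite eqxx Cq ?orbT.
  by rewrite Cq // orbT; case: (Cb _ uC).
Qed.

(** The element covered by [q] inside [C] is covered by [q] in [S] too, by saturation, and is the
    maximum of what remains. *)
Lemma chains_belast (p q : T) (C : {set T}) : p != q -> C \in chains p q ->
  exists2 v, covers lt S v q & C :\ q \in chains p v.
Proof.
move=> pq /chainsP[CA Ct Cs [pC qC] Cb].
have ltpq : lt p q by case: (Cb _ qC) => /orP[/eqP E|//]; rewrite E eqxx in pq.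
case: (covers_ex pC qC ltpq) => v vq pv; case/coversP: (vq) => vC _ lvq hvq.
have vC' : v \in C :\ q.
  by rewrite in_setD1 vC andbT; apply/eqP=> vE; rewrite vE ltI in lvq.
exists v; first exact: Cs.
apply/chainsP; split.
- by apply: subset_trans CA; apply: subsetDl.
- by move=> a b /setD1P[_ aC] /setD1P[_ bC]; apply: Ct.
- move=> a b /setD1P[aq aC] /setD1P[bq bC] /coversP[_ _ ab h].
  apply: Cs => //; apply/coversP; split=> // c cC ac cb.
  apply: (h c) => //; rewrite in_setD1 cC andbT; apply/eqP=> cq.
  case: (Cb _ bC) => _ /orP[/eqP E|bq']; first by rewrite E eqxx in bq.
  by rewrite cq in cb; apply: rel_asym cb bq'.
- by split=> //; rewrite in_setD1 pC pq.
- move=> u /setD1P[uq uC]; case: (Cb _ uC) => pu /orP[/eqP E|luq].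
    by rewrite E eqxx in uq.
  split=> //; case/or3P: (Ct u v uC vC) => [->//|->|vu]; rewrite ?orbT //.
  by case: (hvq u).
Qed.

Lemma chains_max_uniq (p v v' : T) (C : {set T}) :
  C \in chains p v -> C \in chains p v' -> v = v'.
Proof.
move=> /chainsP[_ _ _ [_ vC] Cb] /chainsP[_ _ _ [_ v'C] Cb'].
case: (Cb _ v'C) => _ /orP[/eqP->//|l]; case: (Cb' _ vC) => _ /orP[/eqP->//|l'].
by case: (rel_asym l l').
Qed.

Lemma chains1 (p : T) : p \in A -> chains p p = [set [set p]].
Proof.
move=> pA; apply/setP=> C; rewrite in_set1; apply/idP/eqP.
  case/chainsP=> _ _ _ [pC _] Cb; apply/setP=> u; rewrite in_set1; apply/idP/eqP=> [|->//].
  by case/Cb=> /orP[/eqP->//|l] /orP[/eqP->//|l']; case: (rel_asym l l').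
move->; apply/chainsP; split; rewrite ?sub1set ?set11 //.
- by move=> a b /set1P-> /set1P->; rewrite eqxx.
- by move=> a b /set1P-> /set1P-> /coversP[_ _]; rewrite ltI.
- by move=> u /set1P->; rewrite eqxx.
Qed.

Lemma chains_notin_max (p q : T) : q \notin A -> chains p q = set0.
Proof.
move=> qA; apply/setP=> C; rewrite in_set0; apply/chainsP=> -[/subsetP CA _ _ [_ qC] _].
by rewrite CA in qA.
Qed.

(** Removing the maximum is a bijection onto pairs of a lower cover [v] of [q] and a chain ending at
    [v], since [v] is recovered as the maximum of that chain. The factor [k] stays abstract: it is
    [x q] for weights and an edge indicator for arborescences. *)
Lemma chains_sum (R : comNzRingType) (w : {set T} -> R) (k : T -> R) (p q : T) :
  p != q -> q \in A ->
  (forall v C, covers lt S v q -> C \in chains p v -> w (q |: C) = k v * w C) ->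
  \sum_(C in chains p q) w C =
  \sum_(v | covers lt S v q) k v * \sum_(C in chains p v) w C.
Proof.
move=> pq qA hw.
pose D := [set u : T * {set T} | covers lt S u.1 q & u.2 \in chains p u.1].
have inD u : (u \in D) = covers lt S u.1 q && (u.2 \in chains p u.1).
  by rewrite [LHS]inE.
have -> : chains p q = [set q |: u.2 | u in D].
  apply/setP=> C; apply/idP/imsetP=> [Cpq|[[v C'] /= ]].
    case: (chains_belast pq Cpq) => v vq Cv; exists (v, C :\ q); first by rewrite inD /= vq.
    by rewrite /= setD1K //; case/chainsP: Cpq => _ _ _ [].
  by rewrite inD /= => /andP[vq Cv] ->; case: (chains_rcons qA vq Cv).
rewrite big_imset /=; last first.
  move=> [v C] [v' C']; rewrite !inD /= => /andP[vq Cv] /andP[vq' Cv'] E.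
  have EC : C = C'.
    by rewrite -(setU1K (chains_notin vq Cv)) E (setU1K (chains_notin vq' Cv')).
  by rewrite EC; congr (_, _); apply: chains_max_uniq Cv _; rewrite EC.
under eq_bigl do rewrite inD.
rewrite -(pair_big_dep (fun v => covers lt S v q)
  (fun v C => C \in chains p v) (fun v C => w (q |: C))) /=.
apply: eq_bigr => v vq; rewrite big_distrr /=.
by apply: eq_bigr => C; apply: hw.
Qed.

End Chains.

Definition flip (T : Type) (lt : rel T) : rel T := fun a b => lt b a.

Lemma flip_irr (T : Type) (lt : rel T) : irreflexive lt -> irreflexive (flip lt).
Proof. by move=> h x; apply: h. Qed.

Lemma flip_trans (T : Type) (lt : rel T) : transitive lt -> transitive (flip lt).
Proof. by move=> h y x z xy yz; apply: h yz xy. Qed.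

Lemma covers_flip (T : finType) (lt : rel T) (B : {set T}) (a b : T) :
  covers (flip lt) B a b = covers lt B b a.
Proof.
rewrite /covers /flip andbCA; do 3!congr (_ && _).
by apply: eq_forallb => c; rewrite [lt c a && _]andbC.
Qed.

Lemma saturated_flip (T : finType) (lt : rel T) (S C : {set T}) :
  saturated (flip lt) S C = saturated lt S C.
Proof.
rewrite /saturated; case: (C \subset S) => //=; apply/idP/idP=> /forallP h; apply/forallP=> a;
  apply/forallP=> b; have /forallP/(_ a) := h b; by rewrite !(covers_flip lt).
Qed.

Lemma chains_flip (T : finType) (lt : rel T) (S A : {set T}) (p q : T) :
  chains (flip lt) S A q p = chains lt S A p q.
Proof.
apply/setP=> C; rewrite !inE; congr (_ && _); rewrite [(q \in C) && _]andbCA.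
congr [&& _, _ , _, _ & _].
- apply: eq_forallb => a; congr (_ ==> _); apply: eq_forallb => b; congr (_ ==> _).
  by rewrite /flip [lt b a || _]orbC.
- exact: saturated_flip.
- apply: eq_forallb => a; congr (_ ==> _); rewrite /flip andbC.
  by rewrite (eq_sym p a) (eq_sym q a).
Qed.

(** * Cutting a chain at one of its elements *)

Section Split.
Variables (T : finType) (lt : rel T) (S A : {set T}).
Hypotheses (ltI : irreflexive lt) (ltT : transitive lt) (sAS : A \subset S).
Local Notation chains := (chains lt S A).
Local Notation chainsP := (chainsP _ sAS).

(** Everything in [C1] is at most [p] and everything in [C2] at least [p], so no cover of the union
    can skip [p]. The two identities recover both halves from the union, which makes gluing
    injective. *)
Lemma chains_cat (a p b : T) (C1 C2 : {set T}) :
  C1 \in chains a p -> C2 \in chains p b ->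
  [/\ C1 :|: C2 \in chains a b, C1 = [set u in C1 :|: C2 | (u == p) || lt u p]
    & C2 = [set u in C1 :|: C2 | ~~ lt u p]].
Proof.
case/chainsP=> CA1 Ct1 Cs1 [aC1 pC1] Cb1; case/chainsP=> CA2 Ct2 Cs2 [pC2 bC2] Cb2.
have asym := rel_asym ltI ltT.
have lt12 u v : u \in C1 -> v \in C2 -> (u == v) || lt u v.
  move=> /Cb1[_ up] /Cb2[pv _].
  case/orP: up => [/eqP->//|up]; case/orP: pv => [/eqP<-|pv]; first by rewrite up orbT.
  by rewrite (ltT up pv) orbT.
split.
- apply/chainsP; split.
  + by rewrite subUset CA1.
  + move=> u v /setUP[uC|uC] /setUP[vC|vC]; first exact: Ct1.
    * by case/orP: (lt12 _ _ uC vC) => ->; rewrite ?orbT.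
    * by case/orP: (lt12 _ _ vC uC) => [/eqP->|->]; rewrite ?eqxx ?orbT.
    * exact: Ct2.
  + move=> u v uC vC uv; case/coversP: (uv) => _ _ luv huv.
    case: (boolP ((u \in C1) && (v \in C1))) => [/andP[u1 v1]|n1].
      by apply: Cs1 => //; apply: covers_sub uv => //; apply: subsetUl.
    case: (boolP ((u \in C2) && (v \in C2))) => [/andP[u2 v2]|n2].
      by apply: Cs2 => //; apply: covers_sub uv => //; apply: subsetUr.
    case/setUP: uC => uC; case/setUP: vC => vC; rewrite ?uC ?vC ?andbT // in n1 n2.
      case: (huv p); first by rewrite in_setU pC1.
        by case/Cb1: uC => _ /orP[/eqP up|//]; rewrite up pC2 in n2.
      by case/Cb2: vC => /orP[/eqP up|//]; rewrite -up pC1 in n1.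
    case/orP: (lt12 _ _ vC uC) => [/eqP E|/(asym _ _ luv)//].
    by rewrite E ltI in luv.
  + by split; rewrite in_setU ?aC1 ?bC2 ?orbT.
  + have [ap _] := Cb1 _ pC1; have [pb _] := Cb2 _ bC2.
    move=> u /setUP[uC|uC]; first by case: (Cb1 _ uC) => -> _; split=> //; exact: lt12.
    by case: (Cb2 _ uC) => _ ->; split=> //; apply: lt12.
- apply/setP=> u; rewrite inE in_setU; apply/idP/andP=> [uC|[/orP[//|uC]]].
    by rewrite uC; case: (Cb1 _ uC).
  case/orP=> [/eqP->//|up]; case: (Cb2 _ uC) => /orP[/eqP<- _|pu _].
    by [].
  by case: (asym _ _ up pu).
- apply/setP=> u; rewrite inE in_setU; apply/idP/andP=> [uC|[/orP[uC|//]]].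
    rewrite uC orbT; split=> //; apply/negP=> up.
    case: (Cb2 _ uC) => /orP[/eqP pu|/(asym _ _ up)//] _; by rewrite pu ltI in up.
  by case: (Cb1 _ uC) => _ /orP[/eqP->//|->].
Qed.

Lemma chains_cut (a p b : T) (C : {set T}) : C \in chains a b -> p \in C ->
  [set u in C | (u == p) || lt u p] \in chains a p /\ [set u in C | ~~ lt u p] \in chains p b.
Proof.
have asym := rel_asym ltI ltT.
case/chainsP=> CA Ct Cs [aC bC] Cb pC; split; apply/chainsP; split.
- by apply: subset_trans CA; apply/subsetP=> u; rewrite inE => /andP[].
- by move=> u v; rewrite !inE => /andP[uC _] /andP[vC _]; apply: Ct.
- move=> u v; rewrite !inE => /andP[uC _] /andP[vC vp] /coversP[_ _ uv h].
  apply: Cs => //; apply/coversP; split=> // c cC uc cv; apply: (h c) => //.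
  rewrite inE cC; case/orP: vp => [/eqP<-|vp]; first by rewrite cv orbT.
  by rewrite (ltT cv vp) orbT.
- by rewrite !inE aC pC eqxx; case: (Cb _ pC) => ->.
- by move=> u; rewrite inE => /andP[/Cb[-> _] ->].
- by apply: subset_trans CA; apply/subsetP=> u; rewrite inE => /andP[].
- by move=> u v; rewrite !inE => /andP[uC _] /andP[vC _]; apply: Ct.
- move=> u v; rewrite !inE => /andP[uC up] /andP[vC vp] /coversP[_ _ uv h].
  apply: Cs => //; apply/coversP; split=> // c cC uc cv; apply: (h c) => //.
  rewrite inE cC; apply/negP=> cp; case/negP: up; exact: ltT uc cp.
- rewrite !inE bC pC ltI; split=> //; apply/negP=> bp.
  case: (Cb _ pC) => _ /orP[/eqP E|/(asym _ _ bp)//]; by rewrite E ltI in bp.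
- move=> u; rewrite inE => /andP[uC up]; case: (Cb _ uC) => _ ->; split=> //.
  by case/or3P: (Ct _ _ pC uC) => [->//|->|E]; rewrite ?orbT // E in up *.
Qed.

Lemma chains_sum_split (R : comNzRingType) (w : {set T} -> R) (a p b : T) :
  \sum_(C in chains a b | p \in C) w C =
  \sum_(C1 in chains a p) \sum_(C2 in chains p b) w (C1 :|: C2).
Proof.
pose D := setX (chains a p) (chains p b).
rewrite (eq_bigl (mem [set u.1 :|: u.2 | u in D])) => [|C]; last first.
  apply/andP/imsetP=> [[Cab pC]|[[C1 C2]]].
    case: (chains_cut Cab pC) => C1 C2.
    exists ([set u in C | (u == p) || lt u p], [set u in C | ~~ lt u p]).
      by rewrite in_setX /= C1.
    apply/setP=> u; rewrite !inE /=; case: (u \in C) => //=.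
    by case: (lt u p); rewrite ?orbT.
  rewrite in_setX /= => /andP[C1p C2p] ->; case: (chains_cat C1p C2p) => -> _ _; split=> //.
  by rewrite in_setU; case/chainsP: C1p => _ _ _ [_ ->].
rewrite big_imset /=; last first.
  move=> [C1 C2] [C1' C2']; rewrite !in_setX /= => /andP[C1p C2p] /andP[C1p' C2p'] E.
  have [_ e1 e2] := chains_cat C1p C2p; have [_ e1' e2'] := chains_cat C1p' C2p'.
  by congr (_, _); [rewrite e1 E -e1' | rewrite e2 E -e2'].
rewrite pair_big_dep /=; apply: eq_bigl => -[C1 C2]; exact: in_setX.
Qed.

End Split.

(** * Geometry of skew shapes *)

Definition row (r s : nat) (p : cell r s) : nat := p.1.
Definition col (r s : nat) (p : cell r s) : nat := p.2.

Lemma cell_eq (r s : nat) (p q : cell r s) : row p = row q -> col p = col q -> p = q.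
Proof. by case: p q => [p1 p2] [q1 q2] /val_inj E1 /val_inj E2; congr (_, _). Qed.

Lemma row_lt (r s : nat) (p : cell r s) : (row p < r)%N.
Proof. exact: ltn_ord. Qed.

Lemma col_lt (r s : nat) (p : cell r s) : (col p < s)%N.
Proof. exact: ltn_ord. Qed.

Lemma cell_leE (r s : nat) (p q : cell r s) :
  (p <= q)%O = (row p <= row q)%N && (col p <= col q)%N.
Proof. by []. Qed.

Lemma ltcE (r s : nat) (p q : cell r s) :
  ltc p q = [&& row p <= row q, col p <= col q & row p + col p < row q + col q]%N.
Proof.
rewrite /ltc lt_def cell_leE; apply/andP/and3P=> [[qp /andP[h1 h2]]|[h1 h2 h3]].
  split=> //; rewrite ltnNge; apply: contra qp => h.
  by apply/eqP; apply: cell_eq; lia.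
by rewrite h1 h2; split=> //; apply/eqP=> qp; rewrite qp ltnn in h3.
Qed.

Lemma ltc_irr (r s : nat) : irreflexive (@ltc r s).
Proof. by move=> p; rewrite /ltc ltxx. Qed.

Lemma ltc_trans (r s : nat) : transitive (@ltc r s).
Proof. by move=> q p t; apply: lt_trans. Qed.

Definition step (r s : nat) (a b : cell r s) : bool :=
  ((row b == (row a).+1) && (col b == col a)) || ((row b == row a) && (col b == (col a).+1)).

(** If [b] is not one unit step above [a], moving [a] by one unit toward [b] gives a cell strictly
    between them. *)
Lemma covers_setT (r s : nat) (a b : cell r s) : covers ltc setT a b -> step a b.
Proof.
case/coversP=> _ _; rewrite ltcE => /and3P[h1 h2 h3] hn.
apply: contraT; rewrite /step => n.
case: (ltnP (row a) (row b)) => h.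
  have lt1 : ((row a).+1 < r)%N by apply: leq_ltn_trans h (row_lt b).
  have Er : row (Ordinal lt1, a.2) = (row a).+1 by [].
  have Ec : col (Ordinal lt1, a.2) = col a by [].
  by case: (hn (Ordinal lt1, a.2) (in_setT _)); rewrite ltcE Er Ec; lia.
have lt2 : ((col a).+1 < s)%N by have := col_lt b; lia.
have Er : row (a.1, Ordinal lt2) = row a by [].
have Ec : col (a.1, Ordinal lt2) = (col a).+1 by [].
by case: (hn (a.1, Ordinal lt2) (in_setT _)); rewrite ltcE Er Ec; lia.
Qed.

Section Skew.
Variables (r s : nat) (S : {set cell r s}).
Hypothesis skewS : skew_shape S.

(** Membership by natural coordinates: a position outside the grid just gives [false], so neighbours
    can be named without ordinal bounds. *)
Definition inS (i j : nat) : bool :=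
  [exists p in S, ((row p) == i) && ((col p) == j)].

Lemma inSP (i j : nat) :
  reflect (exists2 p, p \in S & (row p) = i /\ (col p) = j) (inS i j).
Proof.
apply: (iffP exists_inP) => -[p pS].
  by case/andP=> /eqP h1 /eqP h2; exists p.
by case=> <- <-; exists p; rewrite ?eqxx.
Qed.

Lemma mem_inS (p : cell r s) : (p \in S) = inS (row p) (col p).
Proof.
apply/idP/inSP=> [pS|[q qS [h1 h2]]]; first by exists p.
by rewrite (cell_eq (esym h1) (esym h2)).
Qed.

(** Saturation carries covers of [S] to the full grid, where they are unit steps. Conversely a unit
    step raises [row + col] by one and leaves no room for a third cell. *)
Lemma coversE (a b : cell r s) : covers ltc S a b = [&& a \in S, b \in S & step a b].
Proof.
case: skewS => /andP[_ /forallP sat] _ _ _; apply/idP/and3P=> [ab|[aS bS ab]].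
  split; try by case/coversP: ab.
  by apply: covers_setT; move/forallP: (sat a) => /(_ b)/implyP; apply.
apply/coversP; split=> // [|c cS]; first by rewrite ltcE; move: ab; rewrite /step; lia.
rewrite !ltcE; move: ab; rewrite /step; lia.
Qed.

Lemma skew_bot : exists2 p : cell r s, p \in S & (row p) = 0%N /\ (col p) = 0%N.
Proof. by case: skewS. Qed.

Lemma skew_top :
  exists2 p : cell r s, p \in S & (row p) = r.-1 /\ (col p) = s.-1.
Proof. by case: skewS. Qed.

Lemma inS_lower (i j : nat) : inS i j -> (0 < i + j)%N ->
  ((0 < i) && inS i.-1 j || (0 < j) && inS i j.-1)%N.
Proof.
case/inSP=> p pS [<- <-] h; case: skew_bot => b bS [b1 b2].
have bp : ltc b p by rewrite ltcE; lia.
case: (covers_ex (@ltc_irr _ _) (@ltc_trans _ _) bS pS bp) => v vp _.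
move: vp; rewrite coversE mem_inS => /and3P[vS _ /orP[] /andP[/eqP-> /eqP->]] /=.
  by rewrite vS.
by rewrite vS orbT.
Qed.

Lemma inS_upper (i j : nat) : inS i j -> (i + j < r.-1 + s.-1)%N ->
  inS i.+1 j || inS i j.+1.
Proof.
case/inSP=> p pS [<- <-] h; case: skew_top => t tS [t1 t2].
have pt : flip ltc t p.
  by rewrite /flip ltcE; have := row_lt p; have := col_lt p; lia.
case: (covers_ex (flip_irr (@ltc_irr _ _)) (flip_trans (@ltc_trans _ _)) tS pS pt) => v vp _.
move: vp; rewrite covers_flip coversE [v \in S]mem_inS.
by move=> /and3P[_ vS /orP[] /andP[/eqP h1 /eqP h2]]; rewrite h1 h2 in vS; rewrite vS ?orbT.
Qed.

Lemma inS_join (i j : nat) : inS i j.+1 -> inS i.+1 j -> inS i.+1 j.+1.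
Proof.
case/inSP=> p pS [p1 p2] /inSP[q qS [q1 q2]].
case: skewS => _ _ _ h; apply/inSP; exists (q.1, p.2); last by rewrite -q1 -p2.
move: pS qS p1 p2 q1 q2; rewrite /row /col; case: p q => [a b] [c d] /= pS qS p1 p2 q1 q2.
by apply: (h a c d b); rewrite ?q1 ?p1 ?p2 ?q2.
Qed.

Lemma inS_bound (i j : nat) : inS i j -> (i < r)%N /\ (j < s)%N.
Proof. by case/inSP=> p _ [<- <-]; split; [apply: row_lt | apply: col_lt]. Qed.

(** Induction on the rank. The ends have lower neighbours whose rows still enclose both lower
    neighbours of a cell strictly between the ends; these are in [S] by induction, and [inS_join]
    gives the cell. *)
Lemma inS_interval (i j i' j' k l : nat) : inS i j -> inS i' j' ->
  (i + j = i' + j')%N -> (i' <= k <= i)%N -> (k + l = i + j)%N -> inS k l.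
Proof.
elim: {i j}(i + j)%N {-2}i {-2}j (erefl (i + j)%N) i' j' k l
  => [|n IH] i j E i' j' k l ij ij' E' hk El.
  have -> : k = i by lia.
  by have -> : l = j by lia.
have [ki|ki] := eqVneq k i; first by rewrite ki (_ : l = j) //; lia.
have [ki'|ki'] := eqVneq k i'; first by rewrite ki' (_ : l = j') //; lia.
have h1 : exists a b, [/\ inS a b, (a + b = n)%N & (i.-1 <= a)%N].
  have hn : (0 < i + j)%N by rewrite E.
  case/orP: (inS_lower ij hn) => /andP[h0 h].
    by exists i.-1, j; split=> //; lia.
  by exists i, j.-1; split=> //; lia.
have h2 : exists a b, [/\ inS a b, (a + b = n)%N & (a <= i')%N].
  have hn : (0 < i' + j')%N by rewrite -E' E.
  case/orP: (inS_lower ij' hn) => /andP[h0 h].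
    by exists i'.-1, j'; split=> //; lia.
  by exists i', j'.-1; split=> //; lia.
case: h1 h2 => a [b [ab Eab hab]] [c [d [cd Ecd hcd]]].
case: k l ki ki' hk El => [|k] [|l] ki ki' hk El; try lia.
apply: inS_join.
  by apply: (IH a b Eab c d) => //; lia.
by apply: (IH a b Eab c d) => //; lia.
Qed.

Lemma mem_se (u v : cell r s) : (v \in se S u) =
  [&& v \in S, (row v) < (row u) & ((row v) + (col v)).+1 == (row u) + (col u)]%N.
Proof.
rewrite inE -/(row u) -/(row v) -/(col u) -/(col v); congr (_ && _).
apply/asboolP/andP=> [[k [k0 h1 h2]]|[h1 h2]].
  by lia.
exists ((row u)%:Z - 1 - (row v)%:Z); split; lia.
Qed.

Lemma mem_sw (u v : cell r s) : (v \in sw S u) =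
  [&& v \in S, (row u) <= (row v) & ((row v) + (col v)).+1 == (row u) + (col u)]%N.
Proof.
rewrite inE -/(row u) -/(row v) -/(col u) -/(col v); congr (_ && _).
apply/asboolP/andP=> [[k [k0 h1 h2]]|[h1 h2]].
  by lia.
exists ((row u)%:Z - 1 - (row v)%:Z); split; lia.
Qed.

(** If [inS_lower] yields the neighbour in the other direction, that neighbour and the given element
    of [se S u] enclose the wanted cell within their rank. *)
Lemma se_inS (u : cell r s) : u \in S -> se S u != set0 ->
  (0 < row u)%N && inS (row u).-1 (col u).
Proof.
move=> uS /set0Pn[v]; rewrite mem_se mem_inS => /and3P[vS h1 /eqP h2].
rewrite mem_inS in uS; have hn : (0 < row u + col u)%N by rewrite -h2.
case/orP: (inS_lower uS hn) => [//|/andP[h0 h]].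
have -> /= : (0 < (row u))%N by lia.
apply: (inS_interval h vS); lia.
Qed.

Lemma nw_inS (u : cell r s) : u \in S -> nw S u != set0 -> inS (row u).+1 (col u).
Proof.
move=> uS /set0Pn[v]; rewrite inE mem_se => /and3P[vS _ /andP[h1 /eqP h2]].
rewrite mem_inS in vS; have [b1 b2] := inS_bound vS.
rewrite mem_inS in uS; have hn : (row u + col u < r.-1 + s.-1)%N by lia.
case/orP: (inS_upper uS hn) => [//|h].
apply: (inS_interval vS h); lia.
Qed.

(** Either one of the lower neighbours found is [(i, j)] itself, or they lie on its two sides in the
    same rank and [inS_interval] applies. *)
Lemma inS_meet (i j : nat) : inS i j.+1 -> inS i.+1 j -> inS i j.
Proof.
move=> h1 h2; have n1 : (0 < i + j.+1)%N by lia.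
have n2 : (0 < i.+1 + j)%N by lia.
case/orP: (inS_lower h1 n1) => /andP[i0 a //].
case/orP: (inS_lower h2 n2) => /andP[j0 b //].
 apply: (inS_interval b a); lia.
Qed.

End Skew.

(** * Duality of the down and up walks *)

Section Kernels.
Variables (R : comNzRingType) (T : finType).
Implicit Types K L H : T -> T -> R.

Definition apply_kernel K (f : T -> R) (c : T) : R := \sum_v K c v * f v.

Lemma eq_iter_kernel K (f g : T -> R) n : f =1 g ->
  iter n (apply_kernel K) f =1 iter n (apply_kernel K) g.
Proof.
move=> fg; elim: n => //= n IH c; apply: eq_bigr => v _; by rewrite IH.
Qed.

Lemma iter_kernel_sum K (a : T -> R) (f : T -> T -> R) n c :
  iter n (apply_kernel K) (fun v => \sum_y a y * f y v) c =
  \sum_y a y * iter n (apply_kernel K) (f y) c.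
Proof.
elim: n c => // n IH c; rewrite iterS.
have -> : apply_kernel K (iter n (apply_kernel K) (fun v => \sum_y a y * f y v)) c =
    \sum_v K c v * \sum_y a y * iter n (apply_kernel K) (f y) v.
  by apply: eq_bigr => v _; rewrite IH.
under eq_bigr do rewrite big_distrr /=.
rewrite exchange_big; apply: eq_bigr => y _; rewrite iterS [in RHS]big_distrr /=.
by apply: eq_bigr => v _; rewrite mulrCA.
Qed.

(** [K] acts on the first variable of [H] and [L] on the second, so the two actions commute;
    exchanging one step at a time turns [n] steps of [K] into [n] steps of [L]. *)
Lemma iter_kernel_dual K L H :
  (forall c c', apply_kernel K (H^~ c') c = apply_kernel L (H c) c') ->
  forall n c c', iter n (apply_kernel K) (H^~ c') c = iter n (apply_kernel L) (H c) c'.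
Proof.
move=> KL; elim=> // n IH c c'; rewrite iterSr (eq_iter_kernel _ _ (fun v => KL v c')).
by rewrite iter_kernel_sum iterS; apply: eq_bigr => y _; rewrite IH.
Qed.

End Kernels.

(** * Unit squares of a skew shape and the cells at the ends of the chains *)

Definition rank (r s : nat) (p : cell r s) : nat := row p + col p.

Definition Sse (r s : nat) (S : {set cell r s}) : {set cell r s} :=
  [set u in S | se S u != set0].

Definition Snw (r s : nat) (S : {set cell r s}) : {set cell r s} :=
  [set u in S | nw S u != set0].

Definition square (r s : nat) (S : {set cell r s}) (a q1 q2 c : cell r s) : Prop :=
  [/\ [/\ a \in S, q1 \in S, q2 \in S & c \in S],
    row q1 = row a /\ col q1 = (col a).+1, row q2 = (row a).+1 /\ col q2 = col a
    & row c = (row a).+1 /\ col c = (col a).+1].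

Section Boundary.
Variables (r s : nat) (S : {set cell r s}).
Hypothesis skewS : skew_shape S.

Lemma covers_rank v c : covers ltc S v c ->
  [/\ v \in S, c \in S, rank c = (rank v).+1, (row v <= row c)%N & (row c <= (row v).+1)%N].
Proof. by rewrite coversE // /step /rank => /and3P[-> -> h]; split=> //; lia. Qed.

Lemma covers_rank_top v c : covers ltc S v c -> (rank v < r.-1 + s.-1)%N.
Proof.
case/covers_rank=> _ _ rc _ _; rewrite -ltnS -rc ltnS; move: (row_lt c) (col_lt c).
by rewrite /rank; lia.
Qed.

Lemma mem_Sse c : c \in Sse S -> [/\ c \in S, (0 < row c)%N & inS S (row c).-1 (col c)].
Proof. by rewrite inE => /andP[cS h]; case/andP: (se_inS skewS cS h). Qed.

Lemma mem_Snw c : c \in Snw S -> c \in S /\ inS S (row c).+1 (col c).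
Proof. by rewrite inE => /andP[cS h]; split=> //; apply: nw_inS. Qed.

Lemma se_Sse v c : (v \in S) && (c \in se S v) -> v \in Sse S /\ c \in Snw S.
Proof.
case/andP=> vS vc; split; rewrite inE.
  by rewrite vS; apply/set0Pn; exists c.
have cS : c \in S by move: vc; rewrite mem_se => /andP[].
by rewrite cS; apply/set0Pn; exists v; rewrite inE vS.
Qed.

Lemma square_neq (a q1 q2 c : cell r s) : square S a q1 q2 c -> q1 != q2.
Proof.
case=> _ [r1 c1] [r2 c2] _; apply: contra_eq_neq r1 => ->; rewrite r2.
by rewrite gtn_eqF.
Qed.

Lemma square_upper (a q1 q2 c v : cell r s) :
  square S a q1 q2 c -> covers ltc S a v = (v == q1) || (v == q2).
Proof.
case=> -[aS q1S q2S cS] [r1 c1] [r2 c2] [rc cc]; rewrite coversE // /step aS /=.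
apply/andP/orP=> [[vS /orP[]/andP[/eqP h1 /eqP h2]]|[]/eqP->].
- by right; apply/eqP/cell_eq; rewrite ?h1 ?h2.
- by left; apply/eqP/cell_eq; rewrite ?h1 ?h2.
- by rewrite r1 c1 !eqxx orbT.
- by rewrite r2 c2 !eqxx.
Qed.

Lemma square_lower (a q1 q2 c v : cell r s) :
  square S a q1 q2 c -> covers ltc S v c = (v == q1) || (v == q2).
Proof.
case=> -[aS q1S q2S cS] [r1 c1] [r2 c2] [rc cc]; rewrite coversE // /step cS rc cc !eqSS /=.
apply/andP/orP=> [[vS /orP[]/andP[/eqP h1 /eqP h2]]|[]/eqP->].
- by left; apply/eqP/cell_eq; rewrite ?r1 ?c1.
- by right; apply/eqP/cell_eq; rewrite ?r2 ?c2.
- by rewrite r1 c1 !eqxx.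
- by rewrite r2 c2 !eqxx orbT.
Qed.

Lemma square_sum (V : nmodType) (a q1 q2 c : cell r s) (f : cell r s -> V) :
  square S a q1 q2 c ->
  \sum_(v | covers ltc S v c) f v = f q1 + f q2 /\
  \sum_(v | covers ltc S a v) f v = f q1 + f q2.
Proof.
move=> sq; have n12 := square_neq sq; split.
  rewrite (eq_bigl (fun v => (v == q1) || (v == q2))) => [|v]; last exact: square_lower sq.
  rewrite (bigD1 q1) ?eqxx //= (big_pred1 q2) // => v.
  by case: eqVneq => [->|_]; rewrite /= ?(negPf n12) ?andbT ?andbF.
rewrite (eq_bigl (fun v => (v == q1) || (v == q2))) => [|v]; last exact: square_upper sq.
rewrite (bigD1 q1) ?eqxx //= (big_pred1 q2) // => v.
by case: eqVneq => [->|_]; rewrite /= ?(negPf n12) ?andbT ?andbF.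
Qed.

(** Two upper covers are joined by [inS_join]. Hence the only genuine choices of an upward step are
    made at the bottoms of squares. *)
Lemma upper_cases (a : cell r s) : a \in S -> (rank a < r.-1 + s.-1)%N ->
  (exists y, forall v, covers ltc S a v = (v == y)) \/ exists q1 q2 c, square S a q1 q2 c.
Proof.
move=> aS rk; have := aS; rewrite mem_inS => aS'; have := inS_upper skewS aS' rk.
have uniq y : y \in S -> step a y ->
    (forall v, v \in S -> step a v -> v = y) -> forall v, covers ltc S a v = (v == y).
  move=> yS ay h v; rewrite coversE // aS /=.
  by apply/andP/eqP=> [[vS]|->]; [apply: h|rewrite yS].
case: (boolP (inS S (row a).+1 (col a))) => [/inSP[q2 q2S [r2 c2]]|n2];
  case: (boolP (inS S (row a) (col a).+1)) => [/inSP[q1 q1S [r1 c1]]|n1] // _.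
- right; have : inS S (row a).+1 (col a).+1.
    by apply: (inS_join skewS); [rewrite -r1 -c1 -mem_inS | rewrite -r2 -c2 -mem_inS].
  by case/inSP=> c cS [rc cc]; exists q1, q2, c.
- left; exists q2; apply: uniq => //; first by rewrite /step r2 c2 !eqxx.
  move=> v; rewrite mem_inS /step => vS /orP[]/andP[/eqP h1 /eqP h2].
    by apply: cell_eq; rewrite ?h1 ?h2.
  by rewrite h1 h2 (negPf n1) in vS.
- left; exists q1; apply: uniq => //; first by rewrite /step r1 c1 !eqxx orbT.
  move=> v; rewrite mem_inS /step => vS /orP[]/andP[/eqP h1 /eqP h2].
    by rewrite h1 h2 (negPf n2) in vS.
  by apply: cell_eq; rewrite ?h1 ?h2.
Qed.

Lemma lower_cases (c : cell r s) : c \in S -> (0 < rank c)%N ->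
  (exists y, forall v, covers ltc S v c = (v == y)) \/ exists a q1 q2, square S a q1 q2 c.
Proof.
move=> cS rk; have := cS; rewrite mem_inS => cS'; have := inS_lower skewS cS' rk.
have uniq y : y \in S -> step y c ->
    (forall v, v \in S -> step v c -> v = y) -> forall v, covers ltc S v c = (v == y).
  move=> yS yc h v; rewrite coversE // cS /=.
  by apply/andP/eqP=> [[vS]|->]; [apply: h|rewrite yS].
case: (boolP ((0 < row c)%N && inS S (row c).-1 (col c))) => [/andP[h1 /inSP[q1 q1S [r1 c1]]]|n1];
  case: (boolP ((0 < col c)%N && inS S (row c) (col c).-1))
    => [/andP[h2 /inSP[q2 q2S [r2 c2]]]|n2] // _.
- right; have : inS S (row c).-1 (col c).-1.
    apply: (inS_meet skewS); [rewrite prednK // -r1 -c1|rewrite prednK // -r2 -c2].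
      by rewrite -mem_inS.
    by rewrite -mem_inS.
  case/inSP=> a aS [ra ca]; exists a, q1, q2; split=> //; by rewrite ?r1 ?c1 ?r2 ?c2 ra ca ?prednK.
- left; exists q1; apply: uniq => //; first by rewrite /step r1 c1 !prednK // !eqxx.
  move=> v; rewrite mem_inS /step => vS /orP[]/andP[/eqP e1 /eqP e2].
    by apply: cell_eq; rewrite ?r1 ?c1 ?e1 ?e2.
  by rewrite e1 e2 /= vS in n2.
- left; exists q2; apply: uniq => //; first by rewrite /step r2 c2 !prednK // !eqxx orbT.
  move=> v; rewrite mem_inS /step => vS /orP[]/andP[/eqP e1 /eqP e2].
    by rewrite e1 e2 /= vS in n1.
  by apply: cell_eq; rewrite ?r2 ?c2 ?e1 ?e2.
Qed.

Section Lower.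
Variables (m' m : cell r s).
Hypotheses (covm : covers ltc S m' m) (swm : sw S m = set0).

(** A cell covered by [m] in the second direction would lie in [sw S m], so only the first direction
    is left. *)
Lemma row_m : row m = (row m').+1 /\ col m = col m'.
Proof.
move: covm; rewrite coversE // => /and3P[m'S mS]; rewrite /step => h.
have : m' \notin sw S m by rewrite swm in_set0.
rewrite mem_sw m'S /=; lia.
Qed.

Lemma covers_m v : covers ltc S v m = (v == m').
Proof.
apply/idP/eqP=> [|->//]; have [E1 E2] := row_m.
rewrite coversE // /step => /and3P[vS mS h].
have : v \notin sw S m by rewrite swm in_set0.
rewrite mem_sw vS /= => n; apply: cell_eq; lia.
Qed.

(** This is the initial value of the walk. If [c] had a larger row than [m], a lower neighbour of
    [c] would have row at least [row m] and so lie in [sw S m]. *)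
Lemma se_m c : c \in S -> rank c = rank m -> (m' \in se S c) = (c == m).
Proof.
move=> cS rc; have [E1 E2] := row_m.
have m'S : m' \in S by case/coversP: covm.
rewrite mem_se m'S /=; apply/andP/eqP=> [[h1 h2]|->]; last by move: E1 E2; lia.
have [e|n] := eqVneq (row c) (row m).
  by apply: cell_eq => //; move: rc; rewrite /rank e; apply: addnI.
have ninS i j : inS S i j -> (row m <= i)%N -> ((i + j).+1 = rank m)%N -> False.
  case/inSP=> p pS [<- <-] hp hr.
  have : p \in sw S m by rewrite mem_sw pS hp /= hr.
  by rewrite swm in_set0.
have hn : (0 < row c + col c)%N by lia.
move: cS; rewrite mem_inS => cS; case/orP: (inS_lower skewS cS hn) => /andP[h0 /ninS h].
  by case: h; move: rc; rewrite /rank; lia.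
by case: h; move: rc; rewrite /rank; lia.
Qed.

End Lower.

Section Upper.
Variables (M' M : cell r s).
Hypotheses (covM : covers ltc S M' M) (neM : ne S M' = set0).

Lemma row_M : row M = (row M').+1 /\ col M = col M'.
Proof.
move: covM; rewrite coversE // => /and3P[m'S mS]; rewrite /step => h.
have : M \notin ne S M' by rewrite neM in_set0.
rewrite inE mem_sw m'S mS /=; lia.
Qed.

Lemma covers_M v : covers ltc S M' v = (v == M).
Proof.
apply/idP/eqP=> [|->//]; have [E1 E2] := row_M.
rewrite coversE // /step => /and3P[M'S vS h].
have : v \notin ne S M' by rewrite neM in_set0.
rewrite inE vS mem_sw M'S /= => n; apply: cell_eq; lia.
Qed.

(** Dually to [se_m], a cell [c] with smaller row than [M'] would have an upper neighbour in
    [ne S M']. *)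
Lemma se_M c : c \in S -> rank c = rank M' -> (c \in se S M) = (c == M').
Proof.
move=> cS rc; have [E1 E2] := row_M.
have MS : M \in S by case/coversP: covM.
rewrite mem_se cS /=; apply/andP/eqP=> [[h1 h2]|->]; last by move: E1 E2; lia.
have [e|n] := eqVneq (row c) (row M').
  by apply: cell_eq => //; move: rc; rewrite /rank e; apply: addnI.
have ninS i j : inS S i j -> (i <= row M')%N -> ((rank M').+1 = i + j)%N -> False.
  case/inSP=> p pS [<- <-] hp hr.
  have : p \in ne S M'.
    by rewrite inE pS /= mem_sw hp -hr /rank eqxx !andbT; case/coversP: covM.
  by rewrite neM in_set0.
have hn : (row c + col c < r.-1 + s.-1)%N.
  have := row_lt M; have := col_lt M; move: rc; rewrite /rank; lia.
move: cS; rewrite mem_inS => cS; case/orP: (inS_upper skewS cS hn) => /ninS h.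
  by case: h; move: rc; rewrite /rank; lia.
by case: h; move: rc; rewrite /rank; lia.
Qed.

End Upper.

End Boundary.

(** * The one-step identity and its iteration *)

Section Duality.
Variables (r s : nat) (S : {set cell r s}).
Hypothesis skewS : skew_shape S.
Variables (R : comNzRingType) (pd pu : cell r s -> cell r s -> R).
Hypothesis pd_sum : forall c, c \in S -> (0 < rank c)%N ->
  \sum_(v | covers ltc S v c) pd c v = 1.
Hypothesis pu_sum : forall c, c \in S -> (rank c < r.-1 + s.-1)%N ->
  \sum_(v | covers ltc S c v) pu c v = 1.
Hypothesis pd_pu : forall a q1 q2 c : cell r s, square S a q1 q2 c -> pd c q2 = pu a q1.

(** [pd c v] plays the role of the probability of stepping down from [c] to [v], and [pu c v] of
    stepping up. The leading indicators kill a walk at cells with empty [se], resp. empty [nw]. *)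
Let D c v := (c \in Sse S)%:R * (if covers ltc S v c then pd c v else 0).
Let U c v := (c \in Snw S)%:R * (if covers ltc S c v then pu c v else 0).
Let H v c : R := ((v \in S) && (c \in se S v))%:R.

Let DE f c : apply_kernel D f c =
  (c \in Sse S)%:R * \sum_(v | covers ltc S v c) pd c v * f v.
Proof.
rewrite /apply_kernel big_distrr [RHS]big_mkcond; apply: eq_bigr => v _ /=.
by rewrite /D; case: ifP => _; rewrite ?mulr0 ?mul0r // mulrA.
Qed.

Let UE f c : apply_kernel U f c =
  (c \in Snw S)%:R * \sum_(v | covers ltc S c v) pu c v * f v.
Proof.
rewrite /apply_kernel big_distrr [RHS]big_mkcond; apply: eq_bigr => v _ /=.
by rewrite /U; case: ifP => _; rewrite ?mulr0 ?mul0r // mulrA.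
Qed.

Let HE v c : (v \in S) && (c \in se S v) =
  [&& v \in S, c \in S, row c < row v & (rank c).+1 == rank v]%N.
Proof. by rewrite mem_se. Qed.

(** Both sides vanish unless [c] is two ranks above [c']. Then [row c] is compared with
    [row c' + 1]: if smaller, no step produces the relation; if larger, every step does and both
    sides are the total mass 1; if equal, [c'] and [c] are opposite corners of a square. *)
Lemma one_step c c' : apply_kernel D (H^~ c') c = apply_kernel U (H c) c'.
Proof.
rewrite DE UE.
(* The left side is killed here, and on the right a nonzero [H c y] would put [c] in [Sse S]. *)
case: (boolP (c \in Sse S)) => cA; last first.
  rewrite mul0r big1 ?mulr0 // => y _; rewrite /H.
  by case: (boolP (_ && _)) => [/se_Sse[]|_]; rewrite ?mulr0 // (negPf cA).
case: (boolP (c' \in Snw S)) => cB; last first.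
  rewrite mul0r big1 ?mulr0 // => y _; rewrite /H.
  by case: (boolP (_ && _)) => [/se_Sse[]|_]; rewrite ?mulr0 // (negPf cB).
rewrite !mul1r.
have [cS c0 cse] := mem_Sse skewS cA; have [cS' cnw] := mem_Snw skewS cB.
have [Er|Nr] := eqVneq (rank c) (rank c').+2; last first.
  rewrite !big1 // => v /(covers_rank skewS)[h1 h2 h3 h4 h5]; rewrite /H HE.
    by case: eqVneq => E; rewrite ?andbF ?mulr0 //; lia.
  by case: eqVneq => E; rewrite ?andbF ?mulr0 //; lia.
case: (ltngtP (row c) (row c').+1) => hc.
- rewrite !big1 // => v /(covers_rank skewS)[h1 h2 h3 h4 h5]; rewrite /H HE.
    by rewrite (_ : (row v < row c)%N = false) ?andbF ?mulr0 //; lia.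
  by rewrite (_ : (row c' < row v)%N = false) ?andbF ?mulr0 //; lia.
- transitivity (1 : R).
    rewrite -(pd_sum cS); last by rewrite /rank; lia.
    apply: eq_bigr => v /(covers_rank skewS)[h1 h2 h3 h4 h5]; rewrite /H HE h1 cS'.
    rewrite (_ : row c' < row v)%N; last by lia.
    by rewrite (_ : (rank c').+1 == rank v) ?mulr1 //; lia.
  rewrite -(pu_sum cS'); last by have := row_lt c; have := col_lt c; move: Er; rewrite /rank; lia.
  apply: eq_bigr => v /(covers_rank skewS)[h1 h2 h3 h4 h5]; rewrite /H HE h2 cS.
  rewrite (_ : row v < row c)%N; last by lia.
  by rewrite (_ : (rank v).+1 == rank c) ?mulr1 //; lia.
(* In the square case only [q2] is in relation with [c'] and only [q1] with [c], so each side has a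
   single term and [pd_pu] equates them. *)
have Ec : col c = (col c').+1 by move: Er; rewrite /rank; lia.
case/inSP: cse => q1 q1S; rewrite hc Ec /= => -[r1 c1].
case/inSP: cnw => q2 q2S [r2 c2].
rewrite (bigD1 q2) /=; last by rewrite coversE // q2S cS /step; lia.
rewrite [RHS](bigD1 q1) /=; last by rewrite coversE // q1S cS' /step; lia.
rewrite big1 => [|v /andP[/(covers_rank skewS)[h1 h2 h3 h4 h5] nv]]; last first.
  rewrite /H HE (_ : row c' < row v = false)%N ?andbF ?mulr0 //.
  apply/negbTE; apply: contra nv => h; apply/eqP; apply: cell_eq; move: h3; rewrite /rank; lia.
rewrite [in RHS]big1 => [|v /andP[/(covers_rank skewS)[h1 h2 h3 h4 h5] nv]]; last first.
  rewrite /H HE (_ : row v < row c = false)%N ?andbF ?mulr0 //.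
  apply/negbTE; apply: contra nv => h; apply/eqP; apply: cell_eq; move: h3; rewrite /rank; lia.
have -> : pd c q2 = pu c' q1 by apply: pd_pu; split.
rewrite /H !HE q2S cS' cS q1S /= r1 r2 hc !ltnSn /=.
rewrite (_ : (rank c').+1 == rank q2); last by rewrite /rank; lia.
by rewrite (_ : (rank q1).+1 == rank c) //; rewrite /rank; lia.
Qed.

Variables (m' m M' M : cell r s).
Hypotheses (covm : covers ltc S m' m) (covM : covers ltc S M' M).
Hypotheses (swm : sw S m = set0) (neM : ne S M' = set0).

Variables (h g : cell r s -> R).
Hypothesis h_base : forall c, c \in S -> rank c = rank m -> h c = (c == m)%:R.
Hypothesis h_rec : forall c, c \in S -> (rank m < rank c)%N ->
  h c = (c \in Sse S)%:R * \sum_(v | covers ltc S v c) pd c v * h v.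
Hypothesis g_base : forall c, c \in S -> rank c = rank M' -> g c = (c == M')%:R.
Hypothesis g_rec : forall c, c \in S -> (rank c < rank M')%N ->
  g c = (c \in Snw S)%:R * \sum_(v | covers ltc S c v) pu c v * g v.

(** [h c] stands for the probability that the killed walk down from [c] reaches [m]. At the rank of
    [m] it is the relation with [m'], by [se_m], and each further rank applies [D] once. *)
Lemma h_iter n c : c \in S -> rank c = (n + rank m)%N ->
  h c = iter n (apply_kernel D) (H^~ m') c.
Proof.
elim: n c => [|n IH] c cS rc; first by rewrite h_base // /= /H cS (se_m skewS covm swm).
rewrite h_rec // ?rc ?addSn ?ltnS ?leq_addl // iterS DE; congr (_ * _).
apply: eq_bigr => v /(covers_rank skewS)[vS _ rv _ _]; rewrite IH //.
by apply/eqP; rewrite -eqSS -rv rc.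
Qed.

Lemma g_iter n c : c \in S -> (n + rank c)%N = rank M' ->
  g c = iter n (apply_kernel U) (H M) c.
Proof.
have MS : M \in S by case/coversP: covM.
elim: n c => [|n IH] c cS rc; first by rewrite g_base // /= /H MS (se_M skewS covM neM).
rewrite g_rec //; last by rewrite -rc addSn ltnS leq_addl.
rewrite iterS UE; congr (_ * _).
apply: eq_bigr => v /(covers_rank skewS)[_ vS rv _ _]; rewrite IH //.
by rewrite rv addnS -addSn.
Qed.

(** Both walks take [rank M - rank m] steps, because [m'] and [M'] are one rank below [m] and
    [M]. *)
Lemma duality : (rank m <= rank M)%N -> h M = g m'.
Proof.
move=> le; have MS : M \in S by case/coversP: covM.
have m'S : m' \in S by case/coversP: covm.
rewrite (@h_iter (rank M - rank m)) ?subnK // (@g_iter (rank M - rank m)) //.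
  exact: iter_kernel_dual one_step _ _ _.
have [m1 m2] := row_m skewS covm swm; have [M1 M2] := row_M skewS covM neM.
by move: le; rewrite /rank; lia.
Qed.

End Duality.

(** * Chains of cells *)

Section ChainsL.
Variables (T : finType) (lt : rel T) (S A : {set T}).
Hypotheses (ltI : irreflexive lt) (ltT : transitive lt) (sAS : A \subset S).

(** Reversing the order exchanges the ends of a chain, so this is [chains_sum] for [flip lt]. *)
Lemma chains_sum_l (R : comNzRingType) (w : {set T} -> R) (k : T -> R) (p q : T) :
  p != q -> p \in A ->
  (forall v C, covers lt S p v -> C \in chains lt S A v q -> w (p |: C) = k v * w C) ->
  \sum_(C in chains lt S A p q) w C =
  \sum_(v | covers lt S p v) k v * \sum_(C in chains lt S A v q) w C.
Proof.
move=> pq pA hw; rewrite -(chains_flip lt).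
rewrite (chains_sum (flip_irr ltI) (flip_trans ltT) sAS (k := k)) //.
- by apply: eq_big => [v|v _]; rewrite ?(covers_flip lt) // (chains_flip lt).
- by rewrite eq_sym.
- by move=> v C; rewrite (covers_flip lt) (chains_flip lt); apply: hw.
Qed.

Lemma chains_prod_r (R : realType) (x : T -> R) (p q : T) :
  p != q -> q \in A -> weight (chains lt S A p q) x =
  \sum_(v | covers lt S v q) x q * weight (chains lt S A p v) x.
Proof.
move=> pq qA; apply: (chains_sum ltI ltT sAS (k := fun=> x q)) => // v C vq Cp.
by rewrite big_setU1 // (chains_notin ltI ltT sAS vq Cp).
Qed.

Lemma chains_prod_l (R : realType) (x : T -> R) (p q : T) :
  p != q -> p \in A -> weight (chains lt S A p q) x =
  \sum_(v | covers lt S p v) x p * weight (chains lt S A v q) x.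
Proof.
move=> pq pA; apply: (chains_sum_l (k := fun=> x p)) => // v C pv Cq.
rewrite big_setU1 //.
apply: (@chains_notin _ (flip lt) S A (flip_irr ltI) (flip_trans ltT) sAS q p v).
  by rewrite (covers_flip lt).
by rewrite (chains_flip lt).
Qed.

End ChainsL.

(** * Extreme cells, admissible chains and maximal chains *)

Section Extrema.
Variables (r s : nat).
Implicit Types p : cell r s.

Lemma ltc_rank (p q : cell r s) : ltc p q -> (rank p < rank q)%N.
Proof. by rewrite ltcE => /and3P[]. Qed.

Lemma le_ltc (p q : cell r s) : (p <= q)%O = (p == q) || ltc p q.
Proof. exact: le_eqVlt. Qed.

Section Bottom.
Variable b : cell r s.
Hypotheses (b1 : row b = 0%N) (b2 : col b = 0%N).

Lemma bot_le (p : cell r s) : (b == p) || ltc b p.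
Proof. by rewrite -le_ltc cell_leE b1 b2. Qed.

Lemma neq_bot (p : cell r s) : (b != p) = (0 < rank p)%N.
Proof.
have := bot_le p; case: eqVneq => [<- _|_ /= /ltc_rank]; first by rewrite /rank b1 b2.
by rewrite {1}/rank b1 b2.
Qed.

End Bottom.

Section Top.
Variable t : cell r s.
Hypotheses (t1 : row t = r.-1) (t2 : col t = s.-1).

Lemma le_top (p : cell r s) : (p == t) || ltc p t.
Proof.
by rewrite -le_ltc cell_leE t1 t2; have := row_lt p; have := col_lt p; lia.
Qed.

Lemma neq_top (p : cell r s) : (p != t) = (rank p < r.-1 + s.-1)%N.
Proof.
have E : rank t = (r.-1 + s.-1)%N by rewrite /rank t1 t2.
have := le_top p; case: eqVneq => [-> _|_ /= /ltc_rank]; first by rewrite E ltnn.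
by rewrite E => ->.
Qed.

End Top.

End Extrema.

Section Weights.
Variables (r s : nat) (S : {set cell r s}).
Hypothesis skewS : skew_shape S.

Lemma Sse_sub : Sse S \subset S.
Proof. by apply/subsetP=> u; rewrite inE => /andP[]. Qed.

Lemma Snw_sub : Snw S \subset S.
Proof. by apply/subsetP=> u; rewrite inE => /andP[]. Qed.

(** A condition imposed on every element of a chain becomes the choice of [A]; this links
    [satchains_se] and [satchains_nw] to [chains]. *)
Lemma satchains_restrict (A : {set cell r s}) (p q : cell r s) (C : {set cell r s}) :
  A \subset S -> (C \in satchains S p q) && (C \subset A) = (C \in chains ltc S A p q).
Proof.
move=> AS; apply/andP/(chainsP _ AS)=> [[]|[CA Ct Cs [pC qC] Cb]].
  rewrite inE => /and5P[/andP[CS /forall_inP Ct] /andP[_ /forallP Cs] pC qC /forall_inP Cb] CA.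
  split=> //.
  - move=> a b aC bC; have /forall_inP/(_ b bC) := Ct a aC.
    by rewrite /Order.comparable !le_ltc eq_sym; case: eqVneq.
  - by move=> a b _ _ ab; have /forallP/(_ b)/implyP := Cs a; apply.
  - by move=> u /Cb; rewrite !le_ltc => /andP[].
split=> //; have CS := subset_trans CA AS; rewrite inE; apply/and5P; split=> //.
- rewrite /is_chain CS; apply/forall_inP=> a aC; apply/forall_inP=> b bC.
  have := Ct a b aC bC.
  by rewrite /Order.comparable !le_ltc [b == a]eq_sym; case: eqVneq.
- rewrite /saturated CS; apply/forallP=> a; apply/forallP=> b; apply/implyP=> ab.
  by apply: Cs (ab); case/coversP: ab.
- by apply/forall_inP=> u /Cb[]; rewrite !le_ltc => -> ->.
Qed.

Lemma satchains_seE (p q : cell r s) : satchains_se S p q = chains ltc S (Sse S) p q.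
Proof.
apply/setP=> C; rewrite -satchains_restrict ?Sse_sub // inE.
case: (boolP (C \in satchains S p q)) => //=; rewrite inE => /and5P[/andP[CS _] _ _ _ _].
apply/forall_inP/subsetP=> h u uC; last by have := h u uC; rewrite inE => /andP[].
by rewrite inE (subsetP CS) //= h.
Qed.

Lemma satchains_nwE (p q : cell r s) : satchains_nw S p q = chains ltc S (Snw S) p q.
Proof.
apply/setP=> C; rewrite -satchains_restrict ?Snw_sub // inE.
case: (boolP (C \in satchains S p q)) => //=; rewrite inE => /and5P[/andP[CS _] _ _ _ _].
apply/forall_inP/subsetP=> h u uC; last by have := h u uC; rewrite inE => /andP[].
by rewrite inE (subsetP CS) //= h.
Qed.

Lemma chains_rank (A : {set cell r s}) (p q : cell r s) (C : {set cell r s}) :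
  A \subset S -> C \in chains ltc S A p q -> (p == q) || (rank p < rank q)%N.
Proof.
move=> AS /(chainsP _ AS)[_ _ _ [pC qC] Cb]; case: (Cb _ pC) => _ /orP[->//|/ltc_rank->].
by rewrite orbT.
Qed.

Lemma chains_eq_rank0 (A : {set cell r s}) (p q : cell r s) :
  A \subset S -> p != q -> (rank q <= rank p)%N -> chains ltc S A p q = set0.
Proof.
move=> AS pq le; apply/setP=> C; rewrite in_set0; apply/negbTE/negP=> /(chains_rank AS).
by rewrite (negPf pq) ltnNge le.
Qed.

Variables (b t : cell r s).
Hypotheses (bS : b \in S) (b1 : row b = 0%N) (b2 : col b = 0%N).
Hypotheses (tS : t \in S) (t1 : row t = r.-1) (t2 : col t = s.-1).

(** A maximal chain contains every cell of [S] comparable to all its members, hence both extreme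
    cells and anything fitting between two consecutive members. The sum in [toggle] thereby runs
    over saturated chains from [b] to [t]. *)
Lemma maxchainE (C : {set cell r s}) : maxchain S C = (C \in chains ltc S S b t).
Proof.
have comp (x y : cell r s) : (x >=< y)%O = [|| x == y, ltc x y | ltc y x].
  by rewrite /Order.comparable !le_ltc [y == x]eq_sym; case: eqVneq.
have chainU (D : {set cell r s}) u : is_chain S D -> u \in S ->
    {in D, forall v, (u >=< v)%O} -> is_chain S (u |: D).
  case/andP=> DS /forall_inP Dt uS hu; rewrite /is_chain subUset sub1set uS DS /=.
  apply/forall_inP=> x /setU1P[->|xD]; apply/forall_inP=> y /setU1P[->|yD].
  - exact: comparablexx.
  - exact: hu.
  - by rewrite comparable_sym hu.
  - exact: (forall_inP (Dt x xD)).
apply/maxsetP/(chainsP _ (subxx S)) => [[CC Cmax]|[CS Ct Cs [bC tC] Cb]].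
  have add u : u \in S -> {in C, forall v, (u >=< v)%O} -> u \in C.
    move=> uS hu; rewrite -(Cmax (u |: C)) ?setU11 ?subsetUr //; exact: chainU.
  case/andP: (CC) => CS /forall_inP Ct.
  have Ct' x y : x \in C -> y \in C -> [|| x == y, ltc x y | ltc y x].
    by move=> xC yC; rewrite -comp; apply: (forall_inP (Ct x xC)).
  split=> //.
  - move=> x y xC yC /coversP[_ _ xy h]; apply/coversP.
    split; rewrite ?(subsetP CS) // => c cS xc cy; apply: (h c) => //.
    apply: add => // v vC; rewrite comp.
    case/or3P: (Ct' v x vC xC) => [/eqP->|vx|xv]; rewrite ?xc ?orbT //.
      by rewrite (ltc_trans vx xc) !orbT.
    case/or3P: (Ct' v y vC yC) => [/eqP->|vy|yv]; rewrite ?cy ?orbT //.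
      by case: (h v).
    by rewrite (ltc_trans cy yv) !orbT.
  - split; apply: add => // v _; rewrite comp.
      by case/orP: (bot_le b1 b2 v) => ->; rewrite ?orbT.
    by rewrite eq_sym; case/orP: (le_top t1 t2 v) => ->; rewrite ?orbT.
  - by move=> u _; split; [exact: bot_le|exact: le_top].
split.
  rewrite /is_chain CS; apply/forall_inP=> x xC; apply/forall_inP=> y yC.
  by rewrite comp; apply: Ct.
move=> D /andP[DS /forall_inP Dt] CD; apply/eqP; rewrite eqEsubset CD andbT.
apply/subsetP=> u uD; apply: contraT => uC.
have uS : u \in S by apply: (subsetP DS).
have ub : b != u by apply: contra uC => /eqP<-.
have bu : ltc b u by move: (bot_le b1 b2 u); rewrite (negPf ub).
(* If [v] is the largest element of [C] below [u], then [u] lies between [v]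
   and its successor [w] in [C], although [w] covers [v] in [S]. *)
pose Q := [pred v : cell r s | (v \in C) && ltc v u].
have Qb : Q b by rewrite /= bC.
case: (@arg_maxnP (cell r s) b Q (fun v => rank v) Qb) => v /andP[vC vu] vmax.
have utop : u != t by apply: contra uC => /eqP->.
have ut : ltc u t by move: (le_top t1 t2 u); rewrite (negPf utop).
have vt : flip ltc t v by apply: ltc_trans vu ut.
case: (covers_ex (flip_irr (@ltc_irr r s)) (flip_trans (@ltc_trans r s)) tC vC vt) => w.
rewrite (covers_flip ltc) => vw _.
have wC : w \in C by case/coversP: vw.
case/coversP: (Cs _ _ vC wC vw) => _ _ lvw hvw.
have /forall_inP/(_ w (subsetP CD _ wC)) := Dt u uD; rewrite comp => /or3P[/eqP E|uw|wu].
- by rewrite E wC in uC.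
- by case: (hvw u uS).
have /vmax : Q w by rewrite /= wC.
by rewrite /= leqNgt ltc_rank.
Qed.

End Weights.

(** * Rowmotion *)

(** The identity of transition probabilities on a square: [u] and [v] are the values of [X] at the
    middle cells, and their inverses are the values of [Z]. *)
Lemma ratio_flip (F : fieldType) (x z u v : F) : x != 0 -> z != 0 -> u != 0 -> v != 0 ->
  u + v != 0 -> x * v / (x * (u + v)) = z * u^-1 / (z * (u^-1 + v^-1)).
Proof.
by move=> x0 z0 u0 v0 uv0; field; rewrite x0 z0 u0 v0 (addrC v) uv0.
Qed.

(** The telescoping step: dividing chain weights by [X] turns their recursion into that of a hitting
    probability. *)
Lemma ratio_chain (F : fieldType) (x f k u v : F) : u != 0 -> v != 0 ->
  x * f * k / v = x * u / v * (f * k / u).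
Proof. by move=> u0 v0; field; rewrite u0 v0. Qed.

Section Rowmotion.
Variables (R : realType) (r s : nat) (S : {set cell r s}).
Hypothesis skewS : skew_shape S.
Variables (b t : cell r s).
Hypotheses (bS : b \in S) (b1 : row b = 0%N) (b2 : col b = 0%N).
Hypotheses (tS : t \in S) (t1 : row t = r.-1) (t2 : col t = s.-1).

Let X x p : R := weight (chains ltc S S b p) x.
Let Z z p : R := weight (chains ltc S S p t) z.

Lemma foldl_toggle_notin (L : seq (cell r s)) (x : cell r s -> R) p :
  p \notin L -> foldl (fun y q => toggle S q y) x L p = x p.
Proof.
elim: L x => //= q L IH x; rewrite inE negb_or => /andP[pq pL].
by rewrite IH // /toggle (negPf pq).
Qed.

(** When [p] is toggled, the cells below it already carry their final values [x], while [p] and the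
    cells above it still carry [z]. Members of a chain through [p] are comparable to [p], so no
    other case occurs. *)
Lemma rowmotion_toggled (L : seq (cell r s)) (x z : cell r s -> R) p :
  linear_extension S L -> {in S, rowmotion S L z =1 x} -> p \in S ->
  (x p)^-1 = \sum_(C in chains ltc S S b t | p \in C)
                \prod_(q in C) (if ltc q p then x q else z q).
Proof.
case=> uL memL incL zx pS.
have pL : p \in L by rewrite memL.
case/splitPr: pL uL memL incL zx => L1 L2 uL memL incL zx.
move: (uL); rewrite cat_uniq /= => /and4P[u1 /norP[p1 n12] p2 u2].
pose y := foldl (fun y q => toggle S q y) z L1.
have rowE : rowmotion S (L1 ++ p :: L2) z = foldl (fun y q => toggle S q y) (toggle S p y) L2.
  by rewrite /rowmotion foldl_cat.
rewrite -zx // rowE foldl_toggle_notin // /toggle eqxx invrK.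
rewrite (eq_bigl (fun C => (C \in chains ltc S S b t) && (p \in C))); last first.
  by move=> C; rewrite (maxchainE bS b1 b2 tS t1 t2).
apply: eq_bigr => C /andP[/(chainsP _ (subxx S))[CS Ct _ _ _] pC].
apply: eq_bigr => q qC.
have qS : q \in S by apply: (subsetP CS).
have qL : q \in L1 ++ p :: L2 by rewrite memL.
case: ifP => qp.
  have q1 : q \in L1.
    have := incL q p qS pS qp; rewrite !index_cat (negPf p1) /= eqxx addn0.
    by case: ifP => // _; rewrite ltnNge leq_addr.
  rewrite -zx // rowE foldl_toggle_notin; last first.
    by apply: contra n12 => q2; apply/hasP; exists q.
  by rewrite /toggle; case: eqVneq => // E; rewrite -E q1 in p1.
rewrite /y foldl_toggle_notin //; apply/negP=> q1.
have pq : ltc p q.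
  case/or3P: (Ct q p qC pC) => [/eqP E||//]; last by rewrite qp.
  by rewrite -E q1 in p1.
have := incL p q pS qS pq; rewrite !index_cat (negPf p1) q1 /= eqxx addn0.
by rewrite ltnNge ltnW // index_mem.
Qed.

(** Cutting the chains at [p] factors the sum of [rowmotion_toggled] into a lower part, equal to
    [X x p / x p], and the upper part [Z z p]. *)
Lemma rowmotion_dual (L : seq (cell r s)) (x z : cell r s -> R) p :
  linear_extension S L -> positive_on S x -> {in S, rowmotion S L z =1 x} -> p \in S ->
  X x p * Z z p = 1.
Proof.
move=> lin x0 zx pS; have xp : x p != 0 by rewrite gt_eqF // x0.
have ltI := @ltc_irr r s; have ltT := @ltc_trans r s.
suff E : (x p)^-1 = (x p)^-1 * X x p * Z z p.
  by apply: (mulfI (invr_neq0 xp)); rewrite mulr1 mulrA -E.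
rewrite {1}(rowmotion_toggled lin zx pS) (chains_sum_split ltI ltT (subxx S)).
rewrite /X /Z /weight -mulrA big_distrl /= big_distrr /=; apply: eq_bigr => C1 C1p.
rewrite mulrA big_distrr /=; apply: eq_bigr => C2 C2p.
have [_ e1 e2] := chains_cat ltI ltT (subxx S) C1p C2p.
have pC1 : p \in C1 by case/(chainsP _ (subxx S)): C1p => _ _ _ [].
have C2n q : q \in C2 -> ltc q p = false by rewrite e2 inE => /andP[_ /negbTE].
have pC2 : p \in C2 by case/(chainsP _ (subxx S)): C2p => _ _ _ [].
have C1n q : q \in C1 -> (q == p) || ltc q p by rewrite {1}e1 inE => /andP[].
have e3 : (C1 :|: C2) :&: C2 = C2 by apply/setIidPr/subsetUr.
have e4 : (C1 :|: C2) :\: C2 = C1 :\ p.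
  apply/setP=> q; rewrite in_setD in_setU in_setD1.
  case: (boolP (q \in C2)) => [q2|q2].
    case: eqVneq => //= qp; apply/esym/negbTE/negP=> /C1n.
    by rewrite (negPf qp) (C2n q q2).
  by rewrite orbF; case: eqVneq => // E; rewrite E pC2 in q2.
(* [p] is counted with its [z] value in [C2], so the [x] part lacks the factor [x p]; it cancels
   against the inverse on the other side. *)
rewrite (big_setID C2) e3 e4 /= mulrC.
congr (_ * _); last by apply: eq_bigr => q /C2n->.
rewrite (big_setD1 p pC1) /= mulrA mulVf // mul1r; apply: eq_bigr => q.
by rewrite in_setD1 => /andP[qp /C1n]; rewrite (negPf qp) /= => ->.
Qed.

Lemma X_rec x p : p \in S -> (0 < rank p)%N ->
  X x p = \sum_(v | covers ltc S v p) x p * X x v.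
Proof.
move=> pS p0; apply: chains_prod_r => //; [exact: ltc_irr|exact: ltc_trans|].
by rewrite (neq_bot b1 b2).
Qed.

Lemma Z_rec z p : p \in S -> (rank p < r.-1 + s.-1)%N ->
  Z z p = \sum_(v | covers ltc S p v) z p * Z z v.
Proof.
move=> pS p0; apply: chains_prod_l => //; [exact: ltc_irr|exact: ltc_trans|].
by rewrite (neq_top t1 t2).
Qed.

Lemma rowmotion_weight (L : seq (cell r s)) (x z : cell r s -> R) (m' m M' M : cell r s) :
  covers ltc S m' m -> covers ltc S M' M -> sw S m = set0 -> ne S M' = set0 ->
  linear_extension S L -> positive_on S x -> {in S, rowmotion S L z =1 x} ->
  weight (satchains_se S m M) x = weight (satchains_nw S m' M') z.
Proof.
move=> covm covM swm neM lin x0 zx; rewrite satchains_seE satchains_nwE.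
have sSse := Sse_sub S; have sSnw := Snw_sub S.
have ltI := @ltc_irr r s; have ltT := @ltc_trans r s.
have [m'S mS rm _ _] := covers_rank skewS covm.
have [M'S MS rM _ _] := covers_rank skewS covM.
have [le|lt] := leqP (rank m) (rank M); last first.
  rewrite !chains_eq_rank0 ?/weight ?big_set0 //; last by rewrite ltnW.
  - by apply: contraTneq lt => E; rewrite rm rM E ltnn.
  - by move: lt; rewrite rm rM ltnS => /ltnW.
  - by apply: contraTneq lt => ->; rewrite ltnn.
have XZ p : p \in S -> X x p * Z z p = 1 by move=> pS; apply: (rowmotion_dual lin).
have Xn p : p \in S -> X x p != 0.
  by move=> /XZ E; apply: contra_eq_neq E => ->; rewrite mul0r eq_sym oner_neq0.
have Zn p : p \in S -> Z z p != 0.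
  by move=> /XZ E; apply: contra_eq_neq E => ->; rewrite mulr0 eq_sym oner_neq0.
have ZX p : p \in S -> Z z p = (X x p)^-1.
  by move=> pS; apply: (mulfI (Xn p pS)); rewrite XZ // mulfV ?Xn.
pose pd c v := x c * X x v / X x c; pose pu c v := z c * Z z v / Z z c.
(* [h c] is the fraction of [X x c] carried by chains through [m] that stay in [Sse S] from [m] on;
   below [m] they contribute [X x m'], as [m'] is the only lower cover of [m]. Dually for [g]. *)
pose h c := weight (chains ltc S (Sse S) m c) x * X x m' / X x c.
pose g c := weight (chains ltc S (Snw S) c M') z * Z z M / Z z c.
(* Since [Z] is inverse to [X], both sides carry the same factor [X x m' / X x M]. *)
suff E : h M = g m'.
  move: E; rewrite /h /g !ZX // !invrK -!mulrA [(X x M)^-1 * _]mulrC.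
  by apply: mulIf; rewrite mulf_neq0 ?invr_neq0 ?Xn.
apply: (@duality _ _ _ skewS _ pd pu _ _ _ m' m M' M covm covM swm neM h g _ _ _ _ le).
- by move=> c cS c0; rewrite /pd -mulr_suml -X_rec // mulfV ?Xn.
- by move=> c cS c0; rewrite /pu -mulr_suml -Z_rec // mulfV ?Zn.
- move=> a q1 q2 c sq; rewrite /pd /pu; have [[aS q1S q2S cS] _ _ [rc cc]] := sq.
  have EX : X x c = x c * (X x q1 + X x q2).
    rewrite X_rec // -?mulr_sumr; last by rewrite /rank rc.
    by rewrite (square_sum skewS _ sq).1.
  have EZ : Z z a = z a * (Z z q1 + Z z q2).
    rewrite Z_rec // -?mulr_sumr; last first.
      by apply: (@covers_rank_top _ _ _ skewS a q1); rewrite (square_upper skewS q1 sq) eqxx.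
    by rewrite (square_sum skewS _ sq).2.
  have := Xn c cS; have := Zn a aS; rewrite EX EZ !ZX // !mulf_eq0 !negb_or.
  case/andP=> za Zs /andP[xc Xs].
  by apply: ratio_flip; rewrite ?Xn.
- move=> c cS rc; rewrite /h; case: eqVneq => [->|n].
    rewrite chains1 //; last first.
      by rewrite inE mS; apply/set0Pn; exists m'; rewrite (se_m skewS covm swm mS) ?eqxx.
    rewrite /weight big_set1 big_set1.
    have -> : X x m = x m * X x m'.
      by rewrite X_rec // ?rm // (big_pred1 m') // => v; exact: covers_m.
    by rewrite mulfV // mulf_neq0 ?Xn // gt_eqF ?x0.
  by rewrite chains_eq_rank0 1?eq_sym ?rc // /weight big_set0 !mul0r.
- move=> c cS rc; rewrite /h.
  case: (boolP (c \in Sse S)) => cA; last first.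
    by rewrite chains_notin_max // /weight big_set0 !mul0r.
  rewrite chains_prod_r //; last by apply: contraTneq rc => ->; rewrite ltnn.
  rewrite mul1r !mulr_suml; apply: eq_bigr => v vc; rewrite /pd.
  have [vS _ _ _ _] := covers_rank skewS vc; have := Xn v vS; have := Xn c cS.
  by move=> *; apply: ratio_chain.
- move=> c cS rc; rewrite /g; case: eqVneq => [->|n].
    rewrite chains1 //; last first.
      rewrite inE M'S; apply/set0Pn; exists M.
      by rewrite inE MS (se_M skewS covM neM M'S) ?eqxx.
    rewrite /weight big_set1 big_set1.
    have E : Z z M' = z M' * Z z M.
      rewrite Z_rec //; first by rewrite (big_pred1 M) // => v; exact: covers_M.
      exact: covers_rank_top covM.
    by rewrite -E mulfV ?Zn.
  by rewrite chains_eq_rank0 ?rc // /weight big_set0 !mul0r.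
- move=> c cS rc; rewrite /g.
  case: (boolP (c \in Snw S)) => cA; last first.
    by rewrite -chains_flip chains_notin_max // /weight big_set0 !mul0r.
  rewrite chains_prod_l //; last by apply: contraTneq rc => ->; rewrite ltnn.
  rewrite mul1r !mulr_suml; apply: eq_bigr => v vc; rewrite /pu.
  have [_ vS _ _ _] := covers_rank skewS vc; have := Zn v vS; have := Zn c cS.
  by move=> *; apply: ratio_chain.
Qed.

End Rowmotion.

(** * Arborescences and the bijection [aleph] *)

Section Segments.
Variable R : realFieldType.
Implicit Types a u t : R.

(** For parallel edges an integer coordinate would equal a half-integer one; the conclusion is
    doubled so that parity refutes it. *)
Lemma cross_row_row (a2 u2 t t' : R) :
  (1 - t) * a2 + t * a2 = (1 - t') * (u2 - 2^-1) + t' * (u2 - 2^-1) -> 2 * a2 + 1 = 2 * u2.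
Proof. by move=> h; lra. Qed.

(** For perpendicular edges the doubled inequalities force [u1 = a1 + 1] and [u2 = a2] once all
    values are integers. *)
Lemma cross_row_col (a1 a2 u1 u2 t t' : R) : 0 <= t <= 1 -> 0 <= t' <= 1 ->
  (1 - t) * a1 + t * (a1 + 1) = (1 - t') * (u1 - 2^-1) + t' * (u1 - 2^-1) ->
  (1 - t) * a2 + t * a2 = (1 - t') * (u2 - 2^-1) + t' * (u2 + 1 - 2^-1) ->
  [/\ 2 * u1 <= 2 * a1 + 3, 2 * (a1 + 1) <= 2 * u1 + 1, 2 * u2 <= 2 * a2 + 1
    & 2 * a2 <= 2 * u2 + 1].
Proof. by move=> /andP[h1 h2] /andP[h3 h4] h5 h6; split; lra. Qed.

End Segments.

Lemma nat_le_half (R : realFieldType) (i j k : nat) :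
  2 * i%:R <= 2 * j%:R + k%:R :> R -> (i.*2 <= j.*2 + k)%N.
Proof. by rewrite -!natrM -natrD ler_nat !mul2n. Qed.

Lemma nat_neq_half (R : realFieldType) (i j : nat) : 2 * i%:R + 1 = 2 * j%:R :> R -> False.
Proof. by rewrite -!natrM natr1 => /eqP; rewrite eqr_nat; lia. Qed.

Lemma segment_cross (R : realType) (r s : nat) (a y u w : cell r s) (p : R * R) :
  step a y -> step u w -> segment (point R a) (point R y) p ->
  segment (translate (point R u)) (translate (point R w)) p ->
  [/\ u = y, row w = (row a).+1 & col w = (col a).+1].
Proof.
move=> ay uw [t [t01 h1 h2]] [t' [t01' h3 h4]].
move: h1 h2 h3 h4; rewrite /translate /point /= -!/(row _) -!/(col _) => -> -> h3 h4.
suff : (row u = row y /\ col u = col y) /\ row w = (row a).+1 /\ col w = (col a).+1.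
  by case=> -[e1 e2] [e3 e4]; split=> //; apply: cell_eq.
have n1 (i : nat) : i.+1%:R = i%:R + 1 :> R by rewrite natr1.
case/orP: ay => /andP[/eqP ey1 /eqP ey2]; case/orP: uw => /andP[/eqP ew1 /eqP ew2];
  rewrite ?ey1 ?ey2 ?ew1 ?ew2 ?(n1 (row a)) ?(n1 (row u)) ?(n1 (col a)) ?(n1 (col u)) in h3 h4 *.
- by case: (nat_neq_half (cross_row_row h4)).
- case: (cross_row_col t01 t01' h3 h4).
  rewrite natr1 => /nat_le_half b1 /(nat_le_half (k := 1)) b2.
  move=> /(nat_le_half (k := 1)) b3 /(nat_le_half (k := 1)) b4; lia.
- case: (cross_row_col t01 t01' h4 h3).
  rewrite natr1 => /nat_le_half b1 /(nat_le_half (k := 1)) b2.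
  move=> /(nat_le_half (k := 1)) b3 /(nat_le_half (k := 1)) b4; lia.
- by case: (nat_neq_half (cross_row_row h3)).
Qed.

Lemma segment_cross_mid (R : realType) (r s : nat) (a y w : cell r s) :
  step a y -> step y w -> row w = (row a).+1 -> col w = (col a).+1 ->
  exists p : R * R, segment (point R a) (point R y) p /\
    segment (translate (point R y)) (translate (point R w)) p.
Proof.
move=> ay yw rw cw.
have half : 0 <= (2^-1 : R) <= 1 by lra.
(* The midpoint of the first edge: as [w] is [a] moved by one in both coordinates, it is also the
   midpoint of the translated second edge. *)
exists (2^-1 * (row a)%:R + 2^-1 * (row y)%:R, 2^-1 * (col a)%:R + 2^-1 * (col y)%:R).
have n1 (i : nat) : i.+1%:R = i%:R + 1 :> R by rewrite natr1.
split; exists 2^-1; split=> //; rewrite /translate /point /= -!/(row _) -!/(col _).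
- by lra.
- by lra.
- case/orP: ay => /andP[/eqP ey1 /eqP ey2]; rewrite rw ey1 ?(n1 (row a)); lra.
- case/orP: ay => /andP[/eqP ey1 /eqP ey2]; rewrite cw ey2 ?(n1 (col a)); lra.
Qed.

Lemma hasseE (T : finType) (lt : rel T) (A : {set T}) (x y : T) :
  ((x, y) \in hasse lt A) = covers lt A x y.
Proof. by rewrite inE. Qed.

Lemma card_eq1P (I : finType) (A : {set I}) :
  reflect (exists2 x, x \in A & {in A, forall y, y = x}) (#|A| == 1%N).
Proof.
apply: (iffP cards1P) => [[x ->]|[x xA h]].
  by exists x; rewrite ?set11 // => y /set1P.
by exists x; apply/setP=> y; rewrite in_set1; apply/idP/eqP=> [/h|->].
Qed.

(** * Arborescences as choices of covers *)

Section Hat.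
Variables (r s : nat) (S : {set cell r s}).
Hypothesis skewS : skew_shape S.
Variables (b t : cell r s).
Hypotheses (bS : b \in S) (b1 : row b = 0%N) (b2 : col b = 0%N).
Hypotheses (tS : t \in S) (t1 : row t = r.-1) (t2 : col t = s.-1).
Implicit Types (T : graph r s) (a c v y : cell r s).

Lemma inl_hat_set v : (inl v \in hat_set S) = (v \in S).
Proof.
apply/setUP/idP=> [[/imsetP[p pS [->]]|/set2P[]]|vS] //.
by left; apply: imset_f.
Qed.

Lemma inr_hat_set (d : bool) : inr d \in hat_set S.
Proof. by apply/setUP; right; apply/set2P; case: d; [right|left]. Qed.

(** An added extremum never lies between two cells. [H] is general because arborescences omit one
    extremum while forced edges refer to both. *)
Lemma covers_inl (H : {set hat r s}) a c : (forall v, (inl v \in H) = (v \in S)) ->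
  covers hat_lt H (inl a) (inl c) = covers ltc S a c.
Proof.
move=> HS; apply/coversP/coversP=> -[]; rewrite ?HS => aS cS ac h; split; rewrite ?HS //.
  by move=> v vS; apply: (h (inl v)); rewrite HS.
by move=> [v|[]] //; rewrite HS => /h.
Qed.

Lemma covers_hat0 (H : {set hat r s}) c : (forall v, (inl v \in H) = (v \in S)) ->
  hat0 \in H -> covers hat_lt H hat0 (inl c) = (c == b).
Proof.
move=> HS H0; apply/coversP/eqP=> [[_ cS _ h]|->].
  apply/eqP; rewrite eq_sym; apply: contraT => bc; case: (h (inl b)) => //; first by rewrite HS.
  by move: (bot_le b1 b2 c); rewrite (negPf bc).
split; rewrite ?HS // => -[v|[]] //= _ _.
move=> vb; case/orP: (bot_le b1 b2 v) => [/eqP vE|bv]; first by rewrite vE ltc_irr in vb.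
exact: rel_asym (@ltc_irr _ _) (@ltc_trans _ _) _ _ bv vb.
Qed.

Lemma covers_hat1 (H : {set hat r s}) c : (forall v, (inl v \in H) = (v \in S)) ->
  hat1 \in H -> covers hat_lt H (inl c) hat1 = (c == t).
Proof.
move=> HS H0; apply/coversP/eqP=> [[cS _ _ h]|->].
  apply/eqP; apply: contraT => bc; case: (h (inl t)) => //; first by rewrite HS.
  by move: (le_top t1 t2 c); rewrite (negPf bc).
split; rewrite ?HS // => -[v|[]] //= _.
move=> tv _; case/orP: (le_top t1 t2 v) => [/eqP vE|vt]; first by rewrite vE ltc_irr in tv.
exact: rel_asym (@ltc_irr _ _) (@ltc_trans _ _) _ _ vt tv.
Qed.

(** An upward arborescence amounts to one lower cover for each cell of positive rank, the edge below
    [b] being compulsory. *)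
Lemma up_arbP T : reflect
  [/\ forall e, e \in T -> e = (hat0, inl b) \/
        exists a c, e = (inl a, inl c) /\ covers ltc S a c,
      (hat0, inl b) \in T
    & forall c, c \in S -> (0 < rank c)%N ->
        exists2 a, covers ltc S a c & forall v, ((inl v, inl c) \in T) = (v == a)]
  (T \in up_arb S).
Proof.
pose H := hat_set S :\ hat1.
have HS v : (inl v \in H) = (v \in S) by rewrite !in_setD1 /= inl_hat_set.
have H0 : hat0 \in H by rewrite in_setD1 inr_hat_set.
have HT (e : hat r s * hat r s) : e \in hasse hat_lt H -> e = (hat0, inl b) \/
    exists a c, e = (inl a, inl c) /\ covers ltc S a c.
  case: e => [[a|[]] [c|[]]]; rewrite hasseE.
  - by rewrite covers_inl // => ac; right; exists a, c.
  - by case/coversP=> _; rewrite !inE.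
  - by case/coversP.
  - by case/coversP; rewrite !inE.
  - by case/coversP; rewrite !inE.
  - by case/coversP.
  - by rewrite covers_hat0 // => /eqP->; left.
  - by case/coversP=> _; rewrite !inE.
  - by case/coversP.
apply: (iffP idP) => [|[h1 h2 h3]].
  rewrite inE -/H => /andP[/subsetP TH /forall_inP Tp].
  have h1 e : e \in T -> e = (hat0, inl b) \/
      exists a c, e = (inl a, inl c) /\ covers ltc S a c by move/TH/HT.
  have h c : c \in S -> exists2 e, e \in T & e.2 = inl c /\
      forall e', e' \in T -> e'.2 = inl c -> e' = e.
    move=> /Tp/card_eq1P[e]; rewrite inE => /andP[eT /eqP ec] he.
    by exists e => //; split=> // e' e'T e'c; apply: he; rewrite inE e'T e'c /=.
  split=> //.
    case: (h b bS) => e eT [eb _]; case: (h1 e eT) => [<- //|[a [c [E ac]]]].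
    move: eb ac; rewrite E /= => -[->] /(covers_rank skewS)[_ _ rb _ _].
    by move: rb; rewrite /rank b1 b2.
  move=> c cS c0; case: (h c cS) => e eT [ec he].
  case: (h1 e eT) => [E|[a [c' [E ac]]]].
    by move: ec c0; rewrite E /= => -[<-]; rewrite /rank b1 b2.
  move: ec; rewrite E /= => -[Ec]; rewrite Ec in E ac; exists a => // v.
  apply/idP/eqP=> [/he/(_ erefl)|->]; first by rewrite E => -[].
  by rewrite -E.
rewrite inE -/H; apply/andP; split.
  apply/subsetP=> e /h1[->|[a [c [-> ac]]]]; rewrite hasseE; first by rewrite covers_hat0.
  by rewrite covers_inl.
apply/forall_inP=> c cS; apply/card_eq1P; case: (posnP (rank c)) => rc.
  have -> : c = b by apply/eqP; move: (neq_bot b1 b2 c); rewrite rc ltnn eq_sym => /negbFE.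
  exists (hat0, inl b); first by rewrite inE h2 /=.
  move=> e; rewrite inE => /andP[/h1[//|[a [c' [-> ac]]]] /eqP[Ec]].
  move: ac; rewrite Ec => /(covers_rank skewS)[_ _ rb _ _].
  by move: rb; rewrite /rank b1 b2.
case: (h3 c cS rc) => a ac ha; exists (inl a, inl c).
  by rewrite inE ha !eqxx.
move=> e; rewrite inE => /andP[eT /eqP]; case: (h1 e eT) => [E|[a' [c' [E ac']]]].
  by move: rc; rewrite E /= => rc [Ec]; move: rc; rewrite -Ec /rank b1 b2.
by move: eT; rewrite E /= => eT [Ec]; move: eT; rewrite Ec ha => /eqP->.
Qed.

Lemma down_arbP T : reflect
  [/\ forall e, e \in T -> e = (inl t, hat1) \/
        exists a c, e = (inl a, inl c) /\ covers ltc S a c,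
      (inl t, hat1) \in T
    & forall a, a \in S -> (rank a < r.-1 + s.-1)%N ->
        exists2 c, covers ltc S a c & forall v, ((inl a, inl v) \in T) = (v == c)]
  (T \in down_arb S).
Proof.
have rt : rank t = (r.-1 + s.-1)%N by rewrite /rank t1 t2.
pose H := hat_set S :\ hat0.
have HS v : (inl v \in H) = (v \in S) by rewrite !in_setD1 /= inl_hat_set.
have H1 : hat1 \in H by rewrite in_setD1 inr_hat_set.
have HT (e : hat r s * hat r s) : e \in hasse hat_lt H -> e = (inl t, hat1) \/
    exists a c, e = (inl a, inl c) /\ covers ltc S a c.
  case: e => [[a|[]] [c|[]]]; rewrite hasseE.
  - by rewrite covers_inl // => ac; right; exists a, c.
  - by rewrite covers_hat1 // => /eqP->; left.
  - by case/coversP.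
  - by case/coversP.
  - by case/coversP.
  - by case/coversP.
  - by case/coversP; rewrite !inE.
  - by case/coversP; rewrite !inE.
  - by case/coversP.
have top_nocover c : covers ltc S t c -> False.
  by move/(covers_rank_top skewS); rewrite rt ltnn.
apply: (iffP idP) => [|[h1 h2 h3]].
  rewrite inE -/H => /andP[/subsetP TH /forall_inP Tp].
  have h1 e : e \in T -> e = (inl t, hat1) \/
      exists a c, e = (inl a, inl c) /\ covers ltc S a c by move/TH/HT.
  have h c : c \in S -> exists2 e, e \in T & e.1 = inl c /\
      forall e', e' \in T -> e'.1 = inl c -> e' = e.
    move=> /Tp/card_eq1P[e]; rewrite inE => /andP[eT /eqP ec] he.
    by exists e => //; split=> // e' e'T e'c; apply: he; rewrite inE e'T e'c /=.
  split=> //.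
    case: (h t tS) => e eT [eb _]; case: (h1 e eT) => [<- //|[a [c [E ac]]]].
    by move: eb ac; rewrite E /= => -[->] /top_nocover.
  move=> c cS c0; case: (h c cS) => e eT [ec he].
  case: (h1 e eT) => [E|[a [c' [E ac]]]].
    by move: ec c0; rewrite E /= => -[<-]; rewrite rt ltnn.
  move: ec; rewrite E /= => -[Ec]; rewrite Ec in E ac; exists c' => // v.
  apply/idP/eqP=> [/he/(_ erefl)|->]; first by rewrite E => -[].
  by rewrite -E.
rewrite inE -/H; apply/andP; split.
  apply/subsetP=> e /h1[->|[a [c [-> ac]]]]; rewrite hasseE; first by rewrite covers_hat1.
  by rewrite covers_inl.
apply/forall_inP=> c cS; apply/card_eq1P; case: (boolP (rank c < r.-1 + s.-1)%N) => rc; last first.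
  have -> : c = t by apply/eqP; move: rc; rewrite -(neq_top t1 t2) negbK.
  exists (inl t, hat1); first by rewrite inE h2 /=.
  move=> e; rewrite inE => /andP[/h1[//|[a [c' [-> ac]]]] /eqP[Ec]].
  by move: ac; rewrite Ec => /top_nocover.
case: (h3 c cS rc) => a ac ha; exists (inl c, inl a).
  by rewrite inE ha !eqxx.
move=> e; rewrite inE => /andP[eT /eqP]; case: (h1 e eT) => [E|[a' [c' [E ac']]]].
  by move: rc; rewrite E /= => rc [Ec]; move: rc; rewrite -Ec rt ltnn.
by move: eT; rewrite E /= => eT [Ec]; move: eT; rewrite Ec ha => /eqP->.
Qed.

Lemma up_arb_square T a q1 q2 c : T \in up_arb S -> square S a q1 q2 c ->
  ((inl q1, inl c) \in T) = ~~ ((inl q2, inl c) \in T).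
Proof.
case/up_arbP=> _ _ h3 sq; have [[_ _ _ cS] _ _ [rc _]] := sq.
have c0 : (0 < rank c)%N by rewrite /rank rc.
have n12 := square_neq sq; case: (h3 c cS c0) => v; rewrite (square_lower skewS v sq) => vq E.
rewrite !E; case/orP: vq => /eqP->; rewrite eqxx ?(negPf n12) //.
by rewrite eq_sym (negPf n12).
Qed.

Lemma down_arb_square T a q1 q2 c : T \in down_arb S -> square S a q1 q2 c ->
  ((inl a, inl q1) \in T) = ~~ ((inl a, inl q2) \in T).
Proof.
case/down_arbP=> _ _ h3 sq; have [[aS _ _ _] _ _ _] := sq.
have aq1 : covers ltc S a q1 by rewrite (square_upper skewS q1 sq) eqxx.
have n12 := square_neq sq; case: (h3 a aS (covers_rank_top skewS aq1)) => v.
rewrite (square_upper skewS v sq) => vq E.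
rewrite !E; case/orP: vq => /eqP->; rewrite eqxx ?(negPf n12) //.
by rewrite eq_sym (negPf n12).
Qed.

Section Aleph.
Variable R : realType.

Lemma meetsP T a y : T \in up_arb S -> step a y ->
  meets R (a, y) T <->
  exists c, [/\ (inl y, inl c) \in T, row c = (row a).+1 & col c = (col a).+1].
Proof.
case/up_arbP=> h1 _ _ ay.
have Tcov u w : (inl u, inl w) \in T -> step u w.
  case/h1=> [//|[a' [c' [[-> ->]]]]]; by rewrite coversE // => /and3P[].
split=> [[[u w] [p [uwT s1 s2]]]|[c [yc rc cc]]].
  by have [<- rw cw] := segment_cross ay (Tcov _ _ uwT) s1 s2; exists w.
have [p [s1 s2]] := segment_cross_mid R ay (Tcov _ _ yc) rc cc.
by exists (y, c), p.
Qed.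

Lemma mem_aleph_edge T a y : ((inl a, inl y) \in aleph R S T) =
  covers ltc S a y && ~~ `[< meets R (a, y) T >] || ((inl a, inl y) \in forced S).
Proof.
rewrite in_setU; congr (_ || _); apply/imsetP/andP=> [[[a' y']]|[ay nm]].
  by rewrite inE hasseE => /andP[ay nm] [-> ->].
by exists (a, y); rewrite // inE hasseE ay.
Qed.

(** [hat1] cannot be a further cover of [a]: it covers only [t], which no cell of [S] covers. *)
Lemma forcedP a y : reflect (covers ltc S a y /\ forall v, covers ltc S a v -> v = y)
  ((inl a, inl y) \in forced S).
Proof.
rewrite inE hasseE (covers_inl _ _ inl_hat_set) /=.
apply: (iffP and3P) => [[ay _ /forallP h]|[ay h]]; split=> //.
- move=> v av; have /implyP := h (inl v).
  by rewrite (covers_inl _ _ inl_hat_set) => /(_ av)/eqP[].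
- by apply: imset_f; case/coversP: ay.
- apply/forallP=> -[v|[]]; apply/implyP.
  + by rewrite (covers_inl _ _ inl_hat_set) => /h->.
  + rewrite (covers_hat1 _ inl_hat_set) ?inr_hat_set // => /eqP E.
    by move: (covers_rank_top skewS ay); rewrite E -(neq_top t1 t2) eqxx.
  + by case/coversP.
Qed.

Lemma aleph_unique T a y v : (forall u, covers ltc S a u = (u == y)) ->
  ((inl a, inl v) \in aleph R S T) = (v == y).
Proof.
move=> ha; rewrite mem_aleph_edge ha; case: eqVneq => [->|n] /=.
  apply/orP; right; apply/forcedP; rewrite ha; split=> // u; by rewrite ha => /eqP.
by apply/negP=> /forcedP[]; rewrite ha (negPf n).
Qed.

(** No edge above [a] is forced, and the edge from [a] to a middle cell is crossed exactly when [T]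
    joins that cell to [c]. As [T] has exactly one of the two edges below [c], the choice is
    exchanged. *)
Lemma aleph_square T a q1 q2 c : T \in up_arb S -> square S a q1 q2 c ->
  ((inl a, inl q1) \in aleph R S T) = ((inl q2, inl c) \in T) /\
  ((inl a, inl q2) \in aleph R S T) = ((inl q1, inl c) \in T).
Proof.
move=> TU sq; have n12 := square_neq sq; have tri := up_arb_square TU sq.
have [[aS q1S q2S cS] _ _ [rc cc]] := sq.
have a1 : covers ltc S a q1 by rewrite (square_upper skewS _ sq) eqxx.
have a2 : covers ltc S a q2 by rewrite (square_upper skewS _ sq) eqxx orbT.
have nf y : ((inl a, inl y) \in forced S) = false.
  apply/negP=> /forcedP[_ h]; move: n12.
  by rewrite (h _ a1) (h _ a2) eqxx.
have E y : covers ltc S a y -> `[< meets R (a, y) T >] = ((inl y, inl c) \in T).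
  rewrite coversE // => /and3P[_ _ ay]; apply/asboolP/idP.
    case/(meetsP TU ay) => c' [yc' rc' cc'].
    by rewrite (cell_eq (etrans rc (esym rc')) (etrans cc (esym cc'))).
  by move=> yc; apply/(meetsP TU ay); exists c.
by rewrite !mem_aleph_edge !nf !orbF a1 a2 !E // tri negbK.
Qed.

Lemma aleph_down T : T \in up_arb S -> aleph R S T \in down_arb S.
Proof.
move=> TU; apply/down_arbP; split.
- move=> e; rewrite in_setU => /orP[/imsetP[[a y]]|].
    by rewrite inE hasseE => /andP[ay _] ->; right; exists a, y.
  case: e => [[a|d] y]; rewrite inE hasseE => /and3P[ay /imsetP[p _ E0] _] //; clear E0.
  case: y ay => [y|[]].
  + by rewrite (covers_inl _ _ inl_hat_set) => ay; right; exists a, y.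
  + by rewrite (covers_hat1 _ inl_hat_set) ?inr_hat_set // => /eqP->; left.
  + by case/coversP.
- rewrite in_setU; apply/orP; right; rewrite inE hasseE /=.
  rewrite (covers_hat1 _ inl_hat_set) ?inr_hat_set // eqxx imset_f //=.
  apply/forallP=> -[v|[]]; apply/implyP => //.
    rewrite (covers_inl _ _ inl_hat_set) => /(covers_rank_top skewS).
    by rewrite -(neq_top t1 t2) eqxx.
  by case/coversP.
- move=> a aS rk; case: (upper_cases skewS aS rk) => [[y hy]|[q1 [q2 [c sq]]]].
    by exists y => [|v]; [rewrite hy eqxx | apply: aleph_unique].
  have [E1 E2] := aleph_square TU sq; have tri := up_arb_square TU sq.
  have n12 := square_neq sq.
  have other v : v != q1 -> v != q2 -> ((inl a, inl v) \in aleph R S T) = false.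
    move=> n1 n2; rewrite mem_aleph_edge (square_upper skewS v sq) (negPf n1) (negPf n2) /=.
    by apply/negP=> /forcedP[]; rewrite (square_upper skewS v sq) (negPf n1) (negPf n2).
  case: (boolP ((inl q2, inl c) \in T)) => q2c.
    exists q1 => [|v]; first by rewrite (square_upper skewS _ sq) eqxx.
    have [->|n1] := eqVneq v q1; first by rewrite E1 q2c.
    by have [->|n2] := eqVneq v q2; [rewrite E2 tri q2c|apply: other].
  exists q2 => [|v]; first by rewrite (square_upper skewS _ sq) eqxx orbT.
  have [->|n1] := eqVneq v q2; first by rewrite E2 tri q2c.
  by have [->|n2] := eqVneq v q1; [rewrite E1 (negPf q2c)|apply: other].
Qed.

(** A cell that is not the top of a square has only one possible lower edge, so the choices at
    squares determine the arborescence. *)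
Lemma up_arb_ext T1 T2 : T1 \in up_arb S -> T2 \in up_arb S ->
  (forall a q1 q2 c, square S a q1 q2 c -> ((inl q1, inl c) \in T1) = ((inl q1, inl c) \in T2)) ->
  T1 = T2.
Proof.
move=> U1 U2 h.
have sub T T' : T \in up_arb S -> T' \in up_arb S ->
    (forall a q1 q2 c, square S a q1 q2 c -> ((inl q1, inl c) \in T) = ((inl q1, inl c) \in T')) ->
    T \subset T'.
  move=> TU TU' E; apply/subsetP=> e eT; have [hT _ _] := elimT (up_arbP _) TU.
  have [_ h2 h3] := elimT (up_arbP _) TU'.
  case: (hT e eT) => [->//|[v [c [E0 vc]]]]; rewrite E0 in eT *.
  have [vS cS rc _ _] := covers_rank skewS vc.
  have c0 : (0 < rank c)%N by rewrite rc.
  case: (lower_cases skewS cS c0) => [[y hy]|[a [q1 [q2 sq]]]].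
    by move: vc; case: (h3 c cS c0) => u; rewrite !hy => /eqP-> ->.
  move: vc eT; rewrite (square_lower skewS v sq) => /orP[]/eqP->; first by rewrite (E _ _ _ _ sq).
  by apply: contraTT; rewrite -(up_arb_square TU' sq) -(up_arb_square TU sq) (E _ _ _ _ sq).
apply/eqP; rewrite eqEsubset !sub // => a q1 q2 c sq; by rewrite (h _ _ _ _ sq).
Qed.

Lemma down_arb_ext T1 T2 : T1 \in down_arb S -> T2 \in down_arb S ->
  (forall a q1 q2 c, square S a q1 q2 c -> ((inl a, inl q1) \in T1) = ((inl a, inl q1) \in T2)) ->
  T1 = T2.
Proof.
move=> U1 U2 h.
have sub T T' : T \in down_arb S -> T' \in down_arb S ->
    (forall a q1 q2 c, square S a q1 q2 c -> ((inl a, inl q1) \in T) = ((inl a, inl q1) \in T')) ->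
    T \subset T'.
  move=> TU TU' E; apply/subsetP=> e eT; have [hT _ _] := elimT (down_arbP _) TU.
  have [_ h2 h3] := elimT (down_arbP _) TU'.
  case: (hT e eT) => [->//|[a [v [E0 av]]]]; rewrite E0 in eT *.
  have [aS vS _ _ _] := covers_rank skewS av.
  have rk := covers_rank_top skewS av.
  case: (upper_cases skewS aS rk) => [[y hy]|[q1 [q2 [c sq]]]].
    by move: av; case: (h3 a aS rk) => u; rewrite !hy => /eqP-> ->.
  move: av eT; rewrite (square_upper skewS v sq) => /orP[]/eqP->; first by rewrite (E _ _ _ _ sq).
  by apply: contraTT; rewrite -(down_arb_square TU' sq) -(down_arb_square TU sq) (E _ _ _ _ sq).
apply/eqP; rewrite eqEsubset !sub // => a q1 q2 c sq; by rewrite (h _ _ _ _ sq).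
Qed.

Lemma aleph_inj : {in up_arb S &, injective (aleph R S)}.
Proof.
move=> T1 T2 U1 U2 E; apply: up_arb_ext => // a q1 q2 c sq.
by rewrite -(aleph_square U1 sq).2 -(aleph_square U2 sq).2 E.
Qed.

(* The inverse of [aleph], by the dual recipe: an edge from [v] to [c] is kept if
   it is the only one below [c] or if its translate crosses no edge of [T]. *)
Definition beth (T : graph r s) : graph r s :=
  (hat0, inl b) |: [set hat_edge e | e in hasse ltc S &
    [forall v, covers ltc S v e.2 ==> (v == e.1)] ||
    [forall a, covers ltc S a e.1 && (row e.2 == (row a).+1) && (col e.2 == (col a).+1) ==>
       ((inl a, inl e.1) \notin T)]].

Lemma mem_beth_edge T v c : ((inl v, inl c) \in beth T) =
  covers ltc S v c && ([forall u, covers ltc S u c ==> (u == v)] ||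
    [forall a, covers ltc S a v && (row c == (row a).+1) && (col c == (col a).+1) ==>
       ((inl a, inl v) \notin T)]).
Proof.
rewrite in_setU1 /=; apply/imsetP/idP=> [[[a' y']]|vc].
  by rewrite inE hasseE => /andP[ay nm] [-> ->]; rewrite ay.
by exists (v, c); rewrite // inE hasseE.
Qed.

Lemma beth_unique T c y v : (forall u, covers ltc S u c = (u == y)) ->
  ((inl v, inl c) \in beth T) = (v == y).
Proof.
move=> hc; rewrite mem_beth_edge hc; case: eqVneq => [->|n] //=.
by apply/orP; left; apply/forallP=> u; apply/implyP; rewrite hc.
Qed.

Lemma beth_square T a q1 q2 c : square S a q1 q2 c ->
  ((inl q1, inl c) \in beth T) = ((inl a, inl q1) \notin T) /\
  ((inl q2, inl c) \in beth T) = ((inl a, inl q2) \notin T).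
Proof.
move=> sq; have n12 := square_neq sq; have [[aS q1S q2S cS] _ _ [rc cc]] := sq.
have c1 : covers ltc S q1 c by rewrite (square_lower skewS _ sq) eqxx.
have c2 : covers ltc S q2 c by rewrite (square_lower skewS _ sq) eqxx orbT.
have E v : covers ltc S v c -> covers ltc S a v ->
    ((inl v, inl c) \in beth T) = ((inl a, inl v) \notin T).
  move=> vc av; rewrite mem_beth_edge vc (_ : [forall u, _ ==> (u == v)] = false) /=; last first.
    apply/negP=> /forallP h; move: n12.
    have /implyP/(_ c1)/eqP-> := h q1; have /implyP/(_ c2)/eqP-> := h q2.
    by rewrite eqxx.
  (* The coordinates of [c] single out the corner [a], so the quantifier in [beth] tests just one
     edge. *)
  apply/forallP/idP=> [/(_ a)|n u]; first by rewrite av rc cc !eqxx.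
  apply/implyP=> /andP[/andP[_ /eqP r'] /eqP c']; rewrite (_ : u = a) //; apply: cell_eq.
    by apply: succn_inj; rewrite -r'.
  by apply: succn_inj; rewrite -c'.
by rewrite !E // (square_upper skewS _ sq) eqxx ?orbT.
Qed.

Lemma beth_up T : T \in down_arb S -> beth T \in up_arb S.
Proof.
move=> TD; apply/up_arbP; split.
- move=> e; rewrite in_setU1 => /orP[/eqP->|/imsetP[[a y]]]; first by left.
  by rewrite inE hasseE => /andP[ay _] ->; right; exists a, y.
- by rewrite setU11.
- move=> c cS rk; case: (lower_cases skewS cS rk) => [[y hy]|[a [q1 [q2 sq]]]].
    by exists y => [|v]; [rewrite hy eqxx | apply: beth_unique].
  have [E1 E2] := beth_square T sq; have tri := down_arb_square TD sq.
  have n12 := square_neq sq.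
  have other v : v != q1 -> v != q2 -> ((inl v, inl c) \in beth T) = false.
    by move=> n1 n2; rewrite mem_beth_edge (square_lower skewS v sq) (negPf n1) (negPf n2).
  case: (boolP ((inl a, inl q2) \in T)) => aq2.
    exists q1 => [|v]; first by rewrite (square_lower skewS _ sq) eqxx.
    have [->|n1] := eqVneq v q1; first by rewrite E1 tri aq2.
    by have [->|n2] := eqVneq v q2; [rewrite E2 aq2|apply: other].
  exists q2 => [|v]; first by rewrite (square_lower skewS _ sq) eqxx orbT.
  have [->|n1] := eqVneq v q2; first by rewrite E2 aq2.
  by have [->|n2] := eqVneq v q1; [rewrite E1 tri aq2|apply: other].
Qed.

(** Both maps exchange the choices at the two ends of a square, and [down_arb_ext] compares only
    these. Together with [aleph_inj] this makes [aleph] bijective. *)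
Lemma bethK T : T \in down_arb S -> aleph R S (beth T) = T.
Proof.
move=> TD; have TU := beth_up TD; apply: down_arb_ext => //; first exact: aleph_down.
move=> a q1 q2 c sq; rewrite (aleph_square TU sq).1 (beth_square T sq).2.
by rewrite (down_arb_square TD sq).
Qed.

End Aleph.
End Hat.

(** * Chains contained in an arborescence, and the theorem *)

Lemma sum_bool_neq0 (I : finType) (A : {set I}) (P : pred I) :
  (\sum_(i in A) (P i)%:R != 0 :> int) = [exists i in A, P i].
Proof.
rewrite -natr_sum pnatr_eq0 sum_nat_eq0 negb_forall.
by apply: eq_existsb => i; rewrite negb_imply eqb0 negbK.
Qed.

Definition edges_in (r s : nat) (T : graph r s) (C : {set cell r s}) : bool :=
  [forall e in hasse ltc C, hat_edge e \in T].

Lemma edges_in_rcons (r s : nat) (S A C : {set cell r s}) (T : graph r s)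
    (p q v : cell r s) : A \subset S -> q \in A -> covers ltc S v q ->
  C \in chains ltc S A p v ->
  edges_in T (q |: C) = ((inl v, inl q) \in T) && edges_in T C.
Proof.
move=> AS qA vq Cv; have [_ E] := chains_rcons (@ltc_irr r s) (@ltc_trans r s) AS qA vq Cv.
apply/forall_inP/andP=> [h|[h0 /forall_inP h] [x y]].
  split; first by apply: (h (v, q)); rewrite hasseE E !eqxx orbT.
  by apply/forall_inP=> -[x y]; rewrite hasseE => xy; apply: h; rewrite hasseE E xy.
by rewrite hasseE E => /orP[xy|/andP[/eqP-> /eqP->] //]; apply: h; rewrite hasseE.
Qed.

Lemma edges_in_cons (r s : nat) (S A C : {set cell r s}) (T : graph r s)
    (p q v : cell r s) : A \subset S -> p \in A -> covers ltc S p v ->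
  C \in chains ltc S A v q ->
  edges_in T (p |: C) = ((inl p, inl v) \in T) && edges_in T C.
Proof.
move=> AS pA pv Cv; rewrite -(chains_flip ltc) in Cv; rewrite -(covers_flip ltc) in pv.
have [_ E'] := chains_rcons (flip_irr (@ltc_irr r s)) (flip_trans (@ltc_trans r s)) AS pA pv Cv.
have E x y : covers ltc (p |: C) x y = covers ltc C x y || (x == p) && (y == v).
  by rewrite -!(covers_flip ltc) E' andbC.
apply/forall_inP/andP=> [h|[h0 /forall_inP h] [x y]].
  split; first by apply: (h (p, v)); rewrite hasseE E !eqxx orbT.
  by apply/forall_inP=> -[x y]; rewrite hasseE => xy; apply: h; rewrite hasseE E xy.
by rewrite hasseE E => /orP[xy|/andP[/eqP-> /eqP->] //]; apply: h; rewrite hasseE.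
Qed.

Lemma edges_in1 (r s : nat) (T : graph r s) (p : cell r s) : edges_in T [set p].
Proof.
apply/forall_inP=> -[x y]; rewrite hasseE => /coversP[/set1P-> /set1P->].
by rewrite ltc_irr.
Qed.

Lemma up_arb_ofE (r s : nat) (S : {set cell r s}) (CC : {set {set cell r s}}) T :
  (T \in up_arb_of S CC) = (T \in up_arb S) && [exists C in CC, edges_in T C].
Proof.
apply/bigcupP/andP=> [[C CCC]|[TU /exists_inP[C CCC TC]]].
  by rewrite inE => /andP[TU TC]; split=> //; apply/exists_inP; exists C.
by exists C => //; rewrite inE TU.
Qed.

Lemma down_arb_ofE (r s : nat) (S : {set cell r s}) (CC : {set {set cell r s}}) T :
  (T \in down_arb_of S CC) = (T \in down_arb S) && [exists C in CC, edges_in T C].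
Proof.
apply/bigcupP/andP=> [[C CCC]|[TU /exists_inP[C CCC TC]]].
  by rewrite inE => /andP[TU TC]; split=> //; apply/exists_inP; exists C.
by exists C => //; rewrite inE TU.
Qed.

Lemma aleph_chains (R : realType) (r s : nat) (S : {set cell r s}) (m' m M' M : cell r s)
    (T : graph r s) :
  skew_shape S -> covers ltc S m' m -> covers ltc S M' M ->
  sw S m = set0 -> ne S M' = set0 -> T \in up_arb S ->
  [exists C in satchains_se S m M, edges_in T C] =
  [exists C in satchains_nw S m' M', edges_in (aleph R S T) C].
Proof.
move=> skewS covm covM swm neM TU; rewrite satchains_seE satchains_nwE.
case: (skew_bot skewS) => b bS [b1 b2]; case: (skew_top skewS) => t tS [t1 t2].
have TD := aleph_down skewS bS b1 b2 tS t1 t2 R TU.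
have sSse := Sse_sub S; have sSnw := Snw_sub S.
have ltI := @ltc_irr r s; have ltT := @ltc_trans r s.
have [m'S mS rm _ _] := covers_rank skewS covm.
have [M'S MS rM _ _] := covers_rank skewS covM.
(* Existence of a chain is nonvanishing of an integer count; the two counts are shown equal, which
   brings the statement within reach of [duality]. *)
rewrite -!sum_bool_neq0; congr (~~ (_ == _)).
have [le|lt] := leqP (rank m) (rank M); last first.
  rewrite !chains_eq_rank0 ?big_set0 //; last by rewrite ltnW.
  - by apply: contraTneq lt => E; rewrite rm rM E ltnn.
  - by move: lt; rewrite rm rM ltnS => /ltnW.
  - by apply: contraTneq lt => ->; rewrite ltnn.
(* Deterministic walks: following the unique edge of [T] below a cell, or of [aleph R S T] above it,
   gives transition weights 0 or 1. *)
pose pd c v : int := ((inl v, inl c) \in T)%:R.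
pose pu c v : int := ((inl c, inl v) \in aleph R S T)%:R.
pose h c : int := \sum_(C in chains ltc S (Sse S) m c) (edges_in T C)%:R.
pose g c : int := \sum_(C in chains ltc S (Snw S) c M') (edges_in (aleph R S T) C)%:R.
change (h M = g m').
apply: (@duality _ _ _ skewS _ pd pu _ _ _ m' m M' M covm covM swm neM h g _ _ _ _ le).
- move=> c cS c0; have [_ _ /(_ c cS c0)[a ac ha]] := elimT (up_arbP skewS bS b1 b2 T) TU.
  rewrite (bigD1 a) //= big1 => [|v /andP[_ /negPf n]]; rewrite /pd ha ?n //.
  by rewrite eqxx addr0.
- move=> c cS c0; have [_ _ /(_ c cS c0)[a ac ha]] :=
    elimT (down_arbP skewS tS t1 t2 _) TD.
  rewrite (bigD1 a) //= big1 => [|v /andP[_ /negPf n]]; rewrite /pu ha ?n //.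
  by rewrite eqxx addr0.
- move=> a q1 q2 c sq; rewrite /pd /pu.
  by case: (aleph_square skewS bS b1 b2 tS t1 t2 R TU sq) => ->.
- move=> c cS rc; rewrite /h; case: eqVneq => [->|n].
    rewrite chains1 //; first by rewrite big_set1 edges_in1.
    by rewrite inE mS; apply/set0Pn; exists m'; rewrite (se_m skewS covm swm mS) ?eqxx.
  by rewrite chains_eq_rank0 1?eq_sym ?rc // big_set0.
- move=> c cS rc; rewrite /h.
  case: (boolP (c \in Sse S)) => cA; last first.
    by rewrite chains_notin_max // big_set0 mul0r.
  rewrite mul1r; apply: chains_sum => //; first by apply: contraTneq rc => ->; rewrite ltnn.
  by move=> v C vc Cv; rewrite (edges_in_rcons _ sSse cA vc Cv) -natrM mulnb.
- move=> c cS rc; rewrite /g; case: eqVneq => [->|n].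
    rewrite chains1 //; first by rewrite big_set1 edges_in1.
    by rewrite inE M'S; apply/set0Pn; exists M; rewrite inE MS (se_M skewS covM neM M'S) ?eqxx.
  by rewrite chains_eq_rank0 ?rc // big_set0.
- move=> c cS rc; rewrite /g.
  case: (boolP (c \in Snw S)) => cA; last first.
    by rewrite -chains_flip chains_notin_max // big_set0 mul0r.
  rewrite mul1r; apply: chains_sum_l => //; first by apply: contraTneq rc => ->; rewrite ltnn.
  by move=> v C vc Cv; rewrite (edges_in_cons _ sSnw cA vc Cv) -natrM mulnb.
Qed.

Theorem lemma3p15 (R : realType) (r s : nat) (S : {set cell r s})
    (m' m M' M : cell r s) :
  (0 < s)%N -> (s <= r)%N -> skew_shape S ->
  covers ltc S m' m -> covers ltc S M' M ->
  sw S m = set0 -> ne S M' = set0 ->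
  ({in up_arb_of S (satchains_se S m M) &, injective (aleph R S)} /\
   [set aleph R S T | T in up_arb_of S (satchains_se S m M)] =
     down_arb_of S (satchains_nw S m' M')) /\
  (forall (L : seq (cell r s)) (x z : cell r s -> R),
     linear_extension S L -> positive_on S x -> positive_on S z ->
     {in S, rowmotion S L z =1 x} ->
     weight (satchains_se S m M) x = weight (satchains_nw S m' M') z).
Proof.
move=> _ _ skewS covm covM swm neM.
case: (skew_bot skewS) => b bS [b1 b2]; case: (skew_top skewS) => t tS [t1 t2].
have key T := @aleph_chains R r s S m' m M' M T skewS covm covM swm neM.
split; first split.
- move=> T1 T2; rewrite !up_arb_ofE => /andP[U1 _] /andP[U2 _].
  exact: (aleph_inj skewS bS b1 b2 tS t1 t2).
- apply/setP=> T'; rewrite down_arb_ofE; apply/imsetP/andP=> [[T]|[TD TC]].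
    rewrite up_arb_ofE => /andP[TU TC] ->; split; last by rewrite -key.
    exact: (aleph_down skewS bS b1 b2 tS t1 t2).
  (* The preimage of [T'] is [beth S b T'], and [key] read backwards supplies its chain. *)
  have E := bethK skewS bS b1 b2 tS t1 t2 R TD.
  have TU := beth_up skewS bS b1 b2 tS t1 t2 TD.
  by exists (beth S b T'); rewrite ?E // up_arb_ofE TU key ?E.
- move=> L x z lin x0 _ zx.
  exact: (rowmotion_weight skewS bS b1 b2 tS t1 t2 covm covM swm neM lin x0 zx).
Qed.
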